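(* In the setting of the context, let $\{w_k\}_{k\in\mathbb{N}}$ be a sequence of iterates generated by the extrapolation primal–dual interior-point method described in the context (run without stopping), and suppose there is a subsequence indexed by $\mathcal K$ with $w_{k+1}\to w^*$ as $k\in\mathcal K\to\infty$. Then the whole sequence $\{w_k\}$ converges to $w^*$; ultimately (for all $k$ sufficiently large) the inner minimization method is not needed, i.e. $\bar w_k$ itself satisfies $\|F^{\mu_k}(\bar w_k)\|\le\epsilon(\mu_k)$ and $w_{k+1}=\bar w_k$; the convergence is componentwise R-convergence of order $\kappa$; and for those components $j$ with $[\dot w^{w^*}(0)]_j\neq0$ the convergence is componentwise Q-convergence of order $\kappa$.
   Context: Problem: minimize $f(x)$ subject to $c_{\mathcal I}(x)\ge0$, $c_{\mathcal E}(x)=0$, with $f,c_i\colon\mathbb{R}^n\to\mathbb{R}$, $c=(c_{\mathcal I}^T,c_{\mathcal E}^T)^T\in\mathbb{R}^m$, and $d\ge3$ the smallest number of times each of $f,c_1,\dots,c_m$ is continuously differentiable. Notation: $g=\nabla f$, $A$ the Jacobian of $c$, $H(x,\lambda)$ the Hessian in $x$ of $f(x)-\lambda^Tc(x)$, $[v]_S$ components indexed by $S$, uppercase = diagonal matrix of the lowercase vector, $e$ all-ones vector, $w=(x,\lambda)$. $F^\mu(x,\lambda)=\bigl(g(x)-A(x)^T\lambda;\ C_{\mathcal I}(x)[\lambda]_{\mathcal I}-\mu e;\ c_{\mathcal E}(x)\bigr)$, with Jacobian $J_F$ in $w$. Let $x^*$ be a KKT point at which LICQ, strict complementarity (multiplier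 $\lambda^*$ with $[\lambda^*]_i>0$ for active inequality indices) and strong second-order sufficiency ($p^TH(x^*,\lambda^* )p\ge\omega\|p\|^2$, $\omega>0$, for all $p$ orthogonal to all active constraint gradients) hold; $\lambda^*$ unique; $w^*=(x^*,\lambda^* )$. Let $w^{w^*,0}$ be the locally unique $(d-1)$ times continuously differentiable function near $0$ with $F^0(w^{w^*,0}(r))=r$, $w^{w^*,0}(0)=w^*$; barrier trajectory $w^{w^*}(\mu)=w^{w^*,0}((0,\mu e^T,0)^T)$ and $\dot w^{w^*}$ its derivative in $\mu$. Extrapolated point: for $\mu>0$ and $w$ with $J_F(w)$ invertible, let $r=F^\mu(w)$, $\mathrm{nml}(r)=r/\|r\|$ ($r\ne0$), $\mathrm{nml}(0)=0$. There are unique vectors $v^{(1)},\dots,v^{(p)}$ such that the polynomial curve $P(\rho)=w+\sum_{q=1}^p v^{(q)}(\rho-\|r\|)^q/q!$ satisfies $F^\mu(P(\rho))=\rho\,\mathrm{nml}(r)+O(|\rho-\|r\|\,|^{p+1})$ (they are obtained recursively by differentiating $F^\mu(w(\rho))=\rho\,\mathrm{nml}(r)$ at $\rho=\|r\|$, each from a linear system with matrix $J_F(w)$); the $p$th-order extrapolation of $w$ for $\mu$ is $P(0)$. Algorithm: inputs $p\in\{1,\dots,d-2\}$, $\kappa\in(1,p+1)$, positive functions $\epsilon,\varphi$ with $\epsilon(\mu)=\Theta(\mu)$ and $\varphi(\mu)=\Theta(\mu^\kappa)$, a starting point $w_0\in\mathbb{R}^{n+m}$ and $\mu_0>0$. For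 $k=0,1,\dots$: if $J_F(w_k)$ is invertible, let $\bar w_k$ be the $p$th-order extrapolation of $w_k$ for $\mu_k$; otherwise $\bar w_k=w_k$. Then, if needed, apply an (unspecified) inner minimization method starting at $\bar w_k$ for the problem with complementarity perturbed by $\mu_k$ until a point $w_{k+1}$ with $\|F^{\mu_k}(w_{k+1})\|\le\epsilon(\mu_k)$ is found (if $\bar w_k$ already satisfies this, $w_{k+1}=\bar w_k$). Set $\mu_{k+1}=\varphi(\mu_k)$.
   Formalization: The formal theorem additionally assumes μ_k → 0; the stated conditions on φ and μ_0 do not force this (e.g. φ(μ)=μ^κ, μ_0=1 gives μ_k ≡ 1), and the claim can fail without it. *)

(* Defs.v *)
From HB Require Import structures.
From mathcomp Require Import all_boot all_order all_algebra.
From mathcomp Require Import all_classical all_reals.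
From mathcomp Require Import topology normedtype derive exp.
Set Implicit Arguments.
Unset Strict Implicit.
Unset Printing Implicit Defensive.
Import Order.TTheory GRing.Theory Num.Theory.
Import numFieldNormedType.Exports.
Local Open Scope ring_scope.

Section IPM.
Context {R : realType}.

Definition norm2 {N : nat} (v : 'cV[R]_N) : R :=
  Num.sqrt (\sum_(i < N) (v i 0) ^+ 2).

Definition ej {N : nat} (i : 'I_N) : 'cV[R]_N := delta_mx i 0.

Definition nml {N : nat} (r : 'cV[R]_N) : 'cV[R]_N :=
  if r == 0 then 0 else (norm2 r)^-1 *: r.

Definition pderiv {N : nat} (h : 'cV[R]_N -> R) (i : 'I_N) (x : 'cV[R]_N) : R :=
  derive1 (fun t : R => h (x + t *: ej i)) 0.

Definition has_pderiv {N : nat} (h : 'cV[R]_N -> R) (i : 'I_N) (x : 'cV[R]_N) : Prop :=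
  derivable (fun t : R => h (x + t *: ej i)) 0 1.

Definition cont_at {N : nat} (h : 'cV[R]_N -> R) (x : 'cV[R]_N) : Prop :=
  forall e : R, 0 < e -> exists2 dl : R, 0 < dl &
    forall y, norm2 (y - x) < dl -> `|h y - h x| < e.

Fixpoint Ck {N : nat} (k : nat) (U : set 'cV[R]_N) (h : 'cV[R]_N -> R) : Prop :=
  (forall x, U x -> cont_at h x) /\
  match k with
  | 0 => True
  | k'.+1 => forall i : 'I_N,
      (forall x, U x -> has_pderiv h i x) /\ Ck k' U (pderiv h i)
  end.

Context {n m : nat}.

Definition grad (h : 'cV[R]_n -> R) (x : 'cV[R]_n) : 'cV[R]_n :=
  \col_i pderiv h i x.
Definition jac (c : 'I_m -> 'cV[R]_n -> R) (x : 'cV[R]_n) : 'M[R]_(m, n) :=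
  \matrix_(i, j) pderiv (c i) j x.
Definition hess (h : 'cV[R]_n -> R) (x : 'cV[R]_n) : 'M[R]_n :=
  \matrix_(i, j) pderiv (pderiv h j) i x.

Definition lagr (f : 'cV[R]_n -> R) (c : 'I_m -> 'cV[R]_n -> R)
  (lam : 'cV[R]_m) (x : 'cV[R]_n) : R := f x - \sum_(i < m) lam i 0 * c i x.
Definition HessL (f : 'cV[R]_n -> R) (c : 'I_m -> 'cV[R]_n -> R) (x : 'cV[R]_n) (lam : 'cV[R]_m) : 'M[R]_n :=
  hess (lagr f c lam) x.

Definition xpart (w : 'cV[R]_(n + m)) : 'cV[R]_n := usubmx w.
Definition lpart (w : 'cV[R]_(n + m)) : 'cV[R]_m := dsubmx w.

(* F^mu(x,lambda) = (g - A^T lambda ; c_i lambda_i - mu (i in I) ; c_i (i in E)).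
   isI i = true iff i is an inequality index. *)
Definition Fmu (isI : pred 'I_m) (f : 'cV[R]_n -> R) (c : 'I_m -> 'cV[R]_n -> R) (mu : R) (w : 'cV[R]_(n + m))
  : 'cV[R]_(n + m) :=
  let x := xpart w in let lam := lpart w in
  col_mx (grad f x - (jac c x)^T *m lam)
         (\col_i (if isI i then c i x * lam i 0 - mu else c i x)).

Definition JF isI f c (mu : R) (w : 'cV[R]_(n + m)) : 'M[R]_(n + m) :=
  \matrix_(i, j) pderiv (fun w' => Fmu isI f c mu w' i 0) j w.

Definition active (isI : pred 'I_m) (c : 'I_m -> 'cV[R]_n -> R) (x : 'cV[R]_n) (i : 'I_m) : Prop :=
  ~~ isI i \/ c i x = 0.

Definition KKT (isI : pred 'I_m) (f : 'cV[R]_n -> R) (c : 'I_m -> 'cV[R]_n -> R) (x : 'cV[R]_n) (lam : 'cV[R]_m) : Prop :=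
  grad f x - (jac c x)^T *m lam = 0 /\
  (forall i, isI i -> 0 <= c i x /\ 0 <= lam i 0 /\ c i x * lam i 0 = 0) /\
  (forall i, ~~ isI i -> c i x = 0).

Definition LICQ (isI : pred 'I_m) (c : 'I_m -> 'cV[R]_n -> R) (x : 'cV[R]_n) : Prop :=
  forall a : 'I_m -> R,
    (forall i, ~ active isI c x i -> a i = 0) ->
    \sum_(i < m) a i *: grad (c i) x = 0 ->
    forall i, a i = 0.

Definition strict_compl (isI : pred 'I_m) (c : 'I_m -> 'cV[R]_n -> R) (x : 'cV[R]_n) (lam : 'cV[R]_m) : Prop :=
  forall i, isI i -> c i x = 0 -> 0 < lam i 0.

Definition strong_SOSC (isI : pred 'I_m) (f : 'cV[R]_n -> R) (c : 'I_m -> 'cV[R]_n -> R) (x : 'cV[R]_n) (lam : 'cV[R]_m) : Prop :=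
  exists2 om : R, 0 < om &
    forall p : 'cV[R]_n,
      (forall i, active isI c x i -> (grad (c i) x)^T *m p = 0) ->
      om * norm2 p ^+ 2 <= (p^T *m HessL f c x lam *m p) 0 0.

Definition murhs (isI : pred 'I_m) (mu : R) : 'cV[R]_(n + m) :=
  col_mx 0 (\col_i (if isI i then mu else 0)).

Definition is_local_inverse (isI : pred 'I_m) (f : 'cV[R]_n -> R) (c : 'I_m -> 'cV[R]_n -> R) (d : nat)
  (wstar : 'cV[R]_(n + m)) (W : 'cV[R]_(n + m) -> 'cV[R]_(n + m)) : Prop :=
  exists2 delta : R, 0 < delta &
    [/\ forall j, Ck d.-1 [set r | norm2 r < delta] (fun r => W r j 0),
        W 0 = wstar,
        forall r, norm2 r < delta -> Fmu isI f c 0 (W r) = r &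
        exists2 eta : R, 0 < eta &
          forall r w, norm2 r < delta -> norm2 (w - wstar) < eta ->
            Fmu isI f c 0 w = r -> w = W r].

Definition btraj (isI : pred 'I_m) (W : 'cV[R]_(n + m) -> 'cV[R]_(n + m)) (mu : R)
  : 'cV[R]_(n + m) := W (murhs isI mu).
Definition btraj_dot0 (isI : pred 'I_m) (W : 'cV[R]_(n + m) -> 'cV[R]_(n + m))
  : 'cV[R]_(n + m) :=
  \col_j derive1 (fun mu : R => btraj isI W mu j 0) 0.

Definition Pcurve (w : 'cV[R]_(n + m)) (v : nat -> 'cV[R]_(n + m)) (p : nat)
  (s rho : R) : 'cV[R]_(n + m) :=
  w + \sum_(1 <= q < p.+1) (((rho - s) ^+ q) / (q`!)%:R) *: v q.

Definition is_extrapolation (isI : pred 'I_m) (f : 'cV[R]_n -> R) (c : 'I_m -> 'cV[R]_n -> R) (p : nat) (mu : R)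
  (w wbar : 'cV[R]_(n + m)) : Prop :=
  let r := Fmu isI f c mu w in
  exists v : nat -> 'cV[R]_(n + m),
    (exists C : R, exists2 delta : R, 0 < delta &
       forall rho : R, `|rho - norm2 r| < delta ->
         norm2 (Fmu isI f c mu (Pcurve w v p (norm2 r) rho) - rho *: nml r)
           <= C * `|rho - norm2 r| ^+ p.+1)
    /\ wbar = Pcurve w v p (norm2 r) 0.

End IPM.

Section Rates.
Context {R : realType}.

Definition bigTheta0 (h : R -> R) (a : R) : Prop :=
  exists c1 c2 mub : R,
    [/\ 0 < c1, 0 < c2, 0 < mub &
        forall mu, 0 < mu -> mu <= mub ->
          c1 * mu `^ a <= h mu /\ h mu <= c2 * mu `^ a].

Definition seq_cvg (u : nat -> R) (l : R) : Prop :=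
  forall e : R, 0 < e -> exists N : nat, forall k, (N <= k)%N -> `|u k - l| < e.

Definition Rconv (kappa : R) (u : nat -> R) (l : R) : Prop :=
  exists beta : R, exists K : nat,
    0 < beta /\ beta < 1 /\
    forall k, (K <= k)%N -> `|u k - l| <= beta `^ (kappa ^+ k).

Definition Qconv (kappa : R) (u : nat -> R) (l : R) : Prop :=
  seq_cvg u l /\
  exists C : R, exists K : nat,
    forall k, (K <= k)%N -> `|u k.+1 - l| <= C * `|u k - l| `^ kappa.

End Rates.

(* Main.v *)
Require Import Defs.
From HB Require Import structures.
From mathcomp Require Import all_boot all_order all_algebra.
From mathcomp Require Import all_classical all_reals.
From mathcomp Require Import topology normedtype derive realfun exp.
From mathcomp Require Import ring lra zify.
Import Order.TTheory GRing.Theory Num.Theory.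
Import numFieldNormedType.Exports.
Local Open Scope ring_scope.

(* The local inverse [W] of [G := F^0] does all the work.  Near [w*] it is Lipschitz and
   undoes [G]; in particular a kernel vector of [J_F] is impossible there.  Writing
   [a := murhs mu], [r := F^mu w] and [s := |r|], the exact curve [t |-> W (a + t nml r)]
   passes through [w] at [t = s] and solves [F^mu = t nml r], so the extrapolation
   polynomial is its Taylor polynomial at [s] and misses the barrier point [W a] by
   [O(s^(p+1))].  As [s = O(mu_(k-1))] at [w_k] and [eps (mu_k)] dominates
   [mu_(k-1)^kappa] with [kappa < p + 1], the extrapolated point is eventually accepted
   and stays near [w*].  Hence [w_(k+1) = W (murhs mu_k) + o(mu_k)], and the rates of the
   components are those of [mu_k]. *)

Set Implicit Arguments.
Unset Strict Implicit.
Unset Printing Implicit Defensive.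

(** * Euclidean norm of column vectors *)

Section Norm2.
Context {R : realType} {N : nat}.
Implicit Types u v : 'cV[R]_N.

(** The linear systems that determine the vectors [v q] are never unfolded. A polynomial of degree
    at most [p] that is [O(t^(p+1))] vanishes, and this alone identifies the extrapolation
    polynomial with a Taylor polynomial. Its remainder costs [p + 1] derivatives of [W], which is
    what [p <= d - 2] provides. Smoothness is expressed by iterated partial derivatives, so each
    estimate in several variables is brought back to a mean value bound on a segment. The size of
    [s] comes from [F^(mu_k)(w_k) = F^(mu_(k-1))(w_k) + (mu_(k-1) - mu_k) murhs 1]: the first term
    is below the previous tolerance [eps (mu_(k-1))], itself [O(mu_(k-1))]. The extrapolation
    estimate holds only close to [w*], where at first only a subsequence is known to lie. A late
    step that starts in a fixed ball also ends in it, so a single such index traps all later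
    iterates. *)

Lemma norm2_ge0 v : 0 <= norm2 v.
Proof. exact: sqrtr_ge0. Qed.

Lemma sqr_norm2 v : norm2 v ^+ 2 = \sum_i v i 0 ^+ 2.
Proof. by rewrite sqr_sqrtr // sumr_ge0 // => i _; exact: sqr_ge0. Qed.

Lemma norm2_le_sqr v (a : R) : 0 <= a -> \sum_i v i 0 ^+ 2 <= a ^+ 2 -> norm2 v <= a.
Proof.
by move=> a0 h; rewrite -(ler_pXn2r (n:=2)) ?nnegrE ?norm2_ge0 // sqr_norm2.
Qed.

Lemma norm2_0 : norm2 (0 : 'cV[R]_N) = 0.
Proof. by rewrite /norm2 big1 ?sqrtr0 // => i _; rewrite mxE expr0n. Qed.

Lemma coord_le_norm2 v i : `|v i 0| <= norm2 v.
Proof.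
rewrite -(ler_pXn2r (n:=2)) ?nnegrE ?norm2_ge0 // sqr_norm2 real_normK ?num_real //.
rewrite (bigD1 i) //= lerDl sumr_ge0 // => j _; exact: sqr_ge0.
Qed.

Lemma norm2_eq0 v : norm2 v = 0 -> v = 0.
Proof.
move=> v0; apply/matrixP => i j; rewrite ord1 mxE; apply/normr0_eq0/le_anti.
by rewrite normr_ge0 -v0 coord_le_norm2.
Qed.

(** Cauchy-Schwarz: expand the sum of squares of [|v| u - |u| v] and divide by [|u| |v|]; zero
    vectors are treated apart. *)
Lemma norm2_dot u v : \sum_i u i 0 * v i 0 <= norm2 u * norm2 v.
Proof.
have [/eqP/norm2_eq0->|u0] := boolP (norm2 u == 0).
  by rewrite big1 ?norm2_0 ?mul0r // => i _; rewrite mxE mul0r.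
have [/eqP/norm2_eq0->|v0] := boolP (norm2 v == 0).
  by rewrite big1 ?norm2_0 ?mulr0 // => i _; rewrite mxE mulr0.
have ab0 : 0 < norm2 u * norm2 v.
  by rewrite lt0r mulf_neq0 // mulr_ge0 // norm2_ge0.
have : 0 <= \sum_i (norm2 v * u i 0 - norm2 u * v i 0) ^+ 2.
  by rewrite sumr_ge0 // => i _; exact: sqr_ge0.
have -> : \sum_i (norm2 v * u i 0 - norm2 u * v i 0) ^+ 2 =
   norm2 v ^+ 2 * (\sum_i u i 0 ^+ 2) - 2 * (norm2 u * norm2 v) * (\sum_i u i 0 * v i 0)
   + norm2 u ^+ 2 * (\sum_i v i 0 ^+ 2).
  rewrite !mulr_sumr -sumrB -big_split /=; apply: eq_bigr => i _; ring.
rewrite -!sqr_norm2 => h; rewrite -(ler_pM2l ab0); nra.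
Qed.

Lemma ler_norm2D u v : norm2 (u + v) <= norm2 u + norm2 v.
Proof.
apply: norm2_le_sqr; first by rewrite addr_ge0 ?norm2_ge0.
have -> : \sum_i ((u + v) i 0) ^+ 2 =
  \sum_i u i 0 ^+ 2 + 2 * (\sum_i u i 0 * v i 0) + \sum_i v i 0 ^+ 2.
  by rewrite mulr_sumr -!big_split /=; apply: eq_bigr => i _; rewrite mxE; ring.
rewrite -!sqr_norm2; have := norm2_dot u v; nra.
Qed.

Lemma norm2Z (a : R) v : norm2 (a *: v) = `|a| * norm2 v.
Proof.
rewrite /norm2 (eq_bigr (fun i => a ^+ 2 * v i 0 ^+ 2)); last first.
  by move=> i _; rewrite mxE exprMn.
by rewrite -mulr_sumr sqrtrM ?sqr_ge0 // sqrtr_sqr.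
Qed.

Lemma norm2N v : norm2 (- v) = norm2 v.
Proof. by rewrite -scaleN1r norm2Z normrN1 mul1r. Qed.

Lemma norm2_distC u v : norm2 (u - v) = norm2 (v - u).
Proof. by rewrite -norm2N opprB. Qed.

Lemma ler_norm2B u v : norm2 (u - v) <= norm2 u + norm2 v.
Proof. by rewrite -(norm2N v) ler_norm2D. Qed.

Lemma ler_norm2_dist v u z : norm2 (u - z) <= norm2 (u - v) + norm2 (v - z).
Proof. by have := ler_norm2D (u - v) (v - z); rewrite addrA subrK. Qed.

Lemma norm2_sum (I : Type) (s : seq I) (P : pred I) (F : I -> 'cV[R]_N) :
  norm2 (\sum_(i <- s | P i) F i) <= \sum_(i <- s | P i) norm2 (F i).
Proof.
elim/big_rec2: _ => [|i y x _ h]; first by rewrite norm2_0.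
by apply: le_trans (ler_norm2D _ _) _; rewrite lerD2l.
Qed.

Lemma norm2_ej (i : 'I_N) : norm2 (ej i : 'cV[R]_N) = 1.
Proof.
rewrite /norm2 (bigD1 i) //= big1 ?addr0 => [|k ki]; first by rewrite mxE !eqxx expr1n sqrtr1.
by rewrite mxE (negbTE ki) expr0n.
Qed.

Lemma norm2_le_sum v : norm2 v <= \sum_i `|v i 0|.
Proof.
have E : v = \sum_i v i 0 *: ej i.
  apply/matrixP => i j; rewrite ord1 summxE (bigD1 i) //= big1 ?addr0.
    by rewrite !mxE !eqxx mulr1.
  by move=> k ki; rewrite !mxE eq_sym (negbTE ki) mulr0.
rewrite {1}E; apply: le_trans (norm2_sum _ _ _) _.
by apply: ler_sum => i _; rewrite norm2Z norm2_ej mulr1.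
Qed.

Lemma norm2_le_const v (a : R) : (forall i, `|v i 0| <= a) -> norm2 v <= N%:R * a.
Proof.
move=> h; apply: le_trans (norm2_le_sum _) _.
apply: le_trans (ler_sum _ (fun i _ => h i)) _.
by rewrite sumr_const card_ord mulr_natl.
Qed.

Lemma sum_le_norm2 v : \sum_i `|v i 0| <= N%:R * norm2 v.
Proof.
apply: le_trans (ler_sum _ (fun i _ => coord_le_norm2 v i)) _.
by rewrite sumr_const card_ord mulr_natl.
Qed.

End Norm2.

(** * One-variable calculus: slopes, mean value bound, Taylor remainder *)

Section OneVariable.
Context {R : realType}.
Implicit Types g : R -> R.

(** Differentiability without a quotient: [tau = 0] is allowed, and increment estimates plug in
    directly. *)
Definition has_slope g (t l : R) := forall e, 0 < e -> exists2 dl, 0 < dl &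
  forall tau, `|tau| < dl -> `|g (t + tau) - g t - tau * l| <= e * `|tau|.

Lemma is_derive_slope g (t l : R) : is_derive t (1 : R) g l <-> has_slope g t l.
Proof.
have quotE k tau : tau != 0 ->
    `|tau^-1 * (g (tau * 1 + t) - g t) - k| * `|tau| = `|g (t + tau) - g t - tau * k|.
  move=> tau0; rewrite -normrM mulrBl mulrAC mulVf // mul1r mulr1 (addrC tau).
  by rewrite (mulrC k).
split=> [[dg <-] e e0|H].
  have /cvgrPdist_le /(_ _ e0) := dg.
  rewrite /dnbhs near_withinE => -[dl /= dl0 hdl].
  exists dl => // tau taud; have [->|tau0] := eqVneq tau 0.
    by rewrite addr0 subrr mul0r subr0 normr0 mulr0.
  rewrite -quotE // ler_wpM2r //.
  by have := hdl tau; rewrite /ball /= sub0r normrN distrC => /(_ taud tau0).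
have cv : ((fun h : R => h^-1 *: ((g \o shift t) (h *: 1) - g t)) @ 0^' --> l)%classic.
  apply/cvgrPdist_le => e e0; have [dl dl0 hdl] := H e e0.
  rewrite /dnbhs near_withinE; exists dl => //= tau.
  rewrite /ball /= sub0r normrN => taud tau0; rewrite distrC.
  by rewrite -(ler_pM2r (_ : 0 < `|tau|)) ?normr_gt0 // quotE // hdl.
apply: DeriveDef; first by apply/cvg_ex; exists l.
exact: (cvg_lim (@Rhausdorff R)).
Qed.

Lemma has_slope_shift g (a t l : R) :
  has_slope (fun s => g (s + a)) t l <-> has_slope g (t + a) l.
Proof.
by split=> H e e0; have [dl dl0 h] := H e e0; exists dl => // tau taud;
  have := h tau taud; rewrite (addrAC t tau a).
Qed.

(* The hypotheses cover the interval symmetric around [a], so that no case split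
   on the order of [a] and [b] is needed by the users. *)
Lemma mean_value_bound g (dg : R -> R) (a b M : R) :
  (forall t, `|t - a| <= `|b - a| -> has_slope g t (dg t)) ->
  (forall t, `|t - a| <= `|b - a| -> `|dg t| <= M) ->
  `|g b - g a| <= M * `|b - a|.
Proof.
move=> Hd HM.
have mvt x y : x < y -> (forall t, x <= t <= y -> `|t - a| <= `|b - a|) ->
    `|g y - g x| <= M * `|y - x|.
  move=> xy sub.
  have dxy t : t \in `]x, y[ -> is_derive t (1 : R) g (dg t).
    by rewrite in_itv /= => /andP[/ltW xt /ltW ty]; apply/is_derive_slope/Hd/sub/andP.
  have cxy : {within `[x, y], continuous g}%classic.
    apply: derivable_within_continuous => t; rewrite in_itv /= => txy.
    by have /is_derive_slope[] := Hd t (sub t txy).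
  have [z + ->] := MVT xy dxy cxy.
  rewrite in_itv /= => /andP[/ltW xz /ltW zy]; rewrite normrM ler_wpM2r //.
  by apply/HM/sub/andP.
have [ab|ba|->] := ltgtP a b; last by rewrite !subrr normr0 mulr0.
- apply: mvt => // t /andP[at_ tb].
  by rewrite !ger0_norm ?subr_ge0 ?lerD2r // ltW.
- rewrite distrC (distrC b); apply: mvt => // t /andP[bt ta].
  by rewrite distrC (distrC b) !ger0_norm ?subr_ge0 ?lerD2l ?lerN2 // ltW.
Qed.

End OneVariable.

Section Slopes.
Context {R : realType}.
Implicit Types (g : R -> R) (t l : R).

Lemma has_slope_ext g1 g2 t l : g1 =1 g2 -> has_slope g1 t l -> has_slope g2 t l.
Proof. by move=> /funext ->. Qed.

Lemma has_slope_cst a t : has_slope (fun=> a) t 0.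
Proof.
by move=> e e0; exists 1 => // tau _; rewrite subrr mulr0 subr0 normr0 mulr_ge0 // ltW.
Qed.

Lemma has_slopeD g1 g2 t l1 l2 : has_slope g1 t l1 -> has_slope g2 t l2 ->
  has_slope (fun s => g1 s + g2 s) t (l1 + l2).
Proof. by move=> /is_derive_slope ? /is_derive_slope ?; apply/is_derive_slope; exact: is_deriveD. Qed.

Lemma has_slopeM g1 g2 t l1 l2 : has_slope g1 t l1 -> has_slope g2 t l2 ->
  has_slope (fun s => g1 s * g2 s) t (g1 t * l2 + g2 t * l1).
Proof. by move=> /is_derive_slope ? /is_derive_slope ?; apply/is_derive_slope; exact: is_deriveM. Qed.

Lemma has_slopeZ a g t l : has_slope g t l -> has_slope (fun s => a * g s) t (a * l).
Proof. by move=> H; have := has_slopeM (has_slope_cst a t) H; rewrite mulr0 addr0. Qed.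

Lemma has_slopeB g1 g2 t l1 l2 : has_slope g1 t l1 -> has_slope g2 t l2 ->
  has_slope (fun s => g1 s - g2 s) t (l1 - l2).
Proof. by move=> /is_derive_slope ? /is_derive_slope ?; apply/is_derive_slope; exact: is_deriveB. Qed.

Lemma has_slope_id t : has_slope id t 1.
Proof. by apply/is_derive_slope; exact: is_derive_id. Qed.

Lemma has_slope_sum (I : Type) (r : seq I) (G : I -> R -> R) (L : I -> R) t :
  (forall i, has_slope (G i) t (L i)) ->
  has_slope (fun s => \sum_(i <- r) G i s) t (\sum_(i <- r) L i).
Proof.
move=> H; elim: r => [|i r IH].
  rewrite big_nil; apply: has_slope_ext (has_slope_cst 0 t) => s; by rewrite big_nil.
rewrite big_cons; apply: has_slope_ext (has_slopeD (H i) IH) => s; by rewrite big_cons.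
Qed.

Lemma has_slope_monomial (s : R) k t :
  has_slope (fun x => (x - s) ^+ k.+1 / k.+1`!%:R) t ((t - s) ^+ k / k`!%:R).
Proof.
have H : has_slope (fun x => x - s) t 1.
  by rewrite -[1]subr0; apply: has_slopeB (has_slope_id t) (has_slope_cst s t).
elim: k => [|k IH].
  rewrite expr0 fact0 divr1; apply: has_slope_ext H => x.
  by rewrite expr1 divr1.
have := has_slopeZ (k.+2%:R^-1) (has_slopeM H IH).
have -> : k.+2%:R^-1 * ((t - s) * ((t - s) ^+ k / k`!%:R) +
    (t - s) ^+ k.+1 / (k.+1)`!%:R * 1) = (t - s) ^+ k.+1 / (k.+1)`!%:R.
  rewrite factS natrM exprS; field.
  by rewrite pnatr_eq0 -lt0n fact_gt0 /= nat1r -natrD !pnatr_eq0.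
apply: has_slope_ext => x; rewrite (factS k.+1) natrM (exprS _ k.+1).
by rewrite invfM; ring.
Qed.

(** By induction on [q]: the remainder vanishes at [s], and its slope is the remainder of one order
    less for the shifted family [g 1, g 2, ...]. Only the order in [|x - s|] matters later, so the
    factorial is dropped from the constant. *)
Lemma taylor_bound q (g : nat -> R -> R) (s x M : R) :
  (forall k t, (k <= q)%N -> `|t - s| <= `|x - s| -> has_slope (g k) t (g k.+1 t)) ->
  (forall t, `|t - s| <= `|x - s| -> `|g q.+1 t| <= M) ->
  `|g 0%N x - \sum_(0 <= k < q.+1) g k s * ((x - s) ^+ k / k`!%:R)| <= M * `|x - s| ^+ q.+1.
Proof.
elim: q g x => [|q IH] g x Hd HM.
  rewrite big_nat1 expr0 fact0 divr1 mulr1 expr1; apply: mean_value_bound => t ts.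
    exact: Hd.
  exact: HM.
pose E t := g 0%N t - \sum_(0 <= k < q.+2) g k s * ((t - s) ^+ k / k`!%:R).
have Es : E s = 0.
  rewrite /E big_nat_recl // big1 => [|k _]; last by rewrite subrr expr0n mul0r mulr0.
  by rewrite expr0 fact0 divr1 mulr1 addr0 subrr.
have M0 : 0 <= M by apply: le_trans (HM s _); rewrite ?subrr ?normr0.
rewrite -[_ - _]/(E x) -[E x]subr0 -Es exprSr mulrA.
apply: (@mean_value_bound _ _
  (fun t => g 1%N t - \sum_(0 <= k < q.+1) g k.+1 s * ((t - s) ^+ k / k`!%:R))) => t ts.
  apply: has_slopeB; first exact: Hd.
  apply: has_slope_ext (_ : has_slope (fun t => g 0%N s +
    \sum_(0 <= k < q.+1) g k.+1 s * ((t - s) ^+ k.+1 / k.+1`!%:R)) t _) => [z|].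
    by rewrite [in RHS]big_nat_recl // expr0 fact0 divr1 mulr1.
  rewrite -[X in has_slope _ _ X]add0r.
  apply: has_slopeD (has_slope_cst _ _) _; apply: has_slope_sum => k.
  exact/has_slopeZ/has_slope_monomial.
apply: le_trans (IH (fun k => g k.+1) t _ _) _.
- by move=> k z kq zs; apply: Hd => //; apply: le_trans ts.
- by move=> z zs; apply: HM; apply: le_trans ts.
by rewrite ler_wpM2l // lerXn2r // nnegrE.
Qed.

Lemma eq0_of_small (a B dl : R) : 0 < dl -> (forall t, 0 < t -> t < dl -> `|a| <= B * t) -> a = 0.
Proof.
move=> dl0 H; apply/eqP; rewrite -normr_eq0; apply/negPn/negP => a0.
have a_gt0 : 0 < `|a| by rewrite lt0r a0 normr_ge0.
have Bp : 0 < `|B| + 1 by rewrite ltr_wpDl.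
(* Chosen so that [(|B| + 1) * t <= |a| / 2], against [|a| <= B * t]. *)
pose t := Num.min (dl / 2) (`|a| / (2 * (`|B| + 1))).
have t0 : 0 < t by rewrite lt_min !divr_gt0 // mulr_gt0.
have tdl : t < dl by rewrite gt_min ltr_pdivrMr //; apply/orP; left; lra.
have := H t t0 tdl; have ta : t <= `|a| / (2 * (`|B| + 1)) by rewrite ge_min lexx orbT.
have {}ta : t * (2 * (`|B| + 1)) <= `|a| by rewrite -ler_pdivlMr // mulr_gt0.
have := ler_norm B; nra.
Qed.

(** Letting [t] tend to 0 kills the constant coefficient; dividing by [t] then lowers both the
    degree and the order of the bound. *)
Lemma poly_small_eq0 p (a : nat -> R) (C dl : R) : 0 < dl ->
  (forall t, 0 < t -> t < dl -> `|\sum_(0 <= q < p) a q * t ^+ q| <= C * t ^+ p) ->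
  forall q, (q < p)%N -> a q = 0.
Proof.
elim: p a => [//|p IH] a dl0 H.
pose B := \sum_(0 <= q < p) `|a q.+1|.
have step t : \sum_(0 <= q < p.+1) a q * t ^+ q =
    a 0%N + t * \sum_(0 <= q < p) a q.+1 * t ^+ q.
  rewrite big_nat_recl // expr0 mulr1 mulr_sumr; congr (_ + _).
  by apply: eq_bigr => i _; rewrite exprS mulrCA.
have tail t : 0 < t -> t < 1 -> `|\sum_(0 <= q < p) a q.+1 * t ^+ q| <= B.
  move=> t0 t1; apply: le_trans (ler_norm_sum _ _ _) _; apply: ler_sum => i _.
  by rewrite normrM ler_piMr // normrX exprn_ile1 // ger0_norm // ltW.
have a0 : a 0%N = 0.
  apply: (@eq0_of_small _ (`|C| + B) (Num.min dl 1)) => [|t t0].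
    by rewrite lt_min dl0 ltr01.
  rewrite lt_min => /andP[tdl t1]; have := H t t0 tdl; rewrite step => Ht.
  have tp : t ^+ p.+1 <= t by rewrite exprS ler_piMr ?exprn_ile1 // ltW.
  have := tail t t0 t1; set S := \sum_(0 <= q < p) _ in Ht * => HS.
  have -> : a 0%N = (a 0%N + t * S) - t * S by rewrite addrK.
  apply: le_trans (ler_normB _ _) _; rewrite mulrDl lerD //; last first.
    by rewrite normrM (gtr0_norm t0) mulrC ler_wpM2r // ltW.
  apply: le_trans Ht _; apply: le_trans (ler_norm _) _.
  by rewrite normrM ler_wpM2l // ger0_norm // exprn_ge0 // ltW.
case=> // q qp; apply: (IH (fun k => a k.+1)) => // t t0 tdl.
have := H t t0 tdl; rewrite step a0 add0r normrM (gtr0_norm t0) exprS mulrCA.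
by rewrite ler_pM2l.
Qed.

End Slopes.

(** Monotonicity in [M] is all that is asked of [P], so [P] may use [M] as a bound and [M^-1] as a
    radius at the same time. *)
Lemma fin_bound (R : realType) (I : finType) (P : I -> R -> Prop) :
  (forall i M M', M <= M' -> P i M -> P i M') ->
  (forall i, exists2 M, 0 < M & P i M) -> exists2 M, 0 < M & forall i, P i M.
Proof.
move=> mono ex.
suff [M M0 HM] : exists2 M, 0 < M & forall i, i \in enum I -> P i M.
  by exists M => // i; apply: HM; rewrite mem_enum.
elim: (enum I) => [|i s [M M0 HM]]; first by exists 1.
have [M' M'0 HM'] := ex i; exists (Num.max M M') => [|j]; first by rewrite lt_max M0.
rewrite inE => /orP[/eqP->|/HM h]; first by apply: mono HM'; rewrite le_max lexx orbT.
by apply: mono h; rewrite le_max lexx.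
Qed.

Lemma fin_radius (R : realType) (I : finType) (P : I -> R -> Prop) :
  (forall i r r', r' <= r -> P i r -> P i r') ->
  (forall i, exists2 r, 0 < r & P i r) -> exists2 r, 0 < r & forall i, P i r.
Proof.
move=> mono ex.
(* The conjunct [0 < M] makes inversion antitone, as the monotonicity hypothesis of [fin_bound]
   requires. *)
have [M M0 HM] : exists2 M, 0 < M & forall i, 0 < M /\ P i M^-1.
  apply: fin_bound => [i M M' MM' [M0 h]|i]; first split; first exact: lt_le_trans MM'.
    by apply: mono h; rewrite lef_pV2 // posrE //; apply: lt_le_trans MM'.
  have [r r0 h] := ex i; exists r^-1; first by rewrite invr_gt0.
  by rewrite invrK invr_gt0.
by exists M^-1; [rewrite invr_gt0 | move=> i; case: (HM i)].
Qed.

(** * From partial derivatives to increments, directional derivatives and Lipschitz bounds *)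

Section Partials.
Context {R : realType} {N : nat}.
Local Notation V := 'cV[R]_N.
Implicit Types (h : V -> R) (x u v b : V) (U : set V).

Lemma pderivP h i x (l : R) : has_slope (fun t => h (x + t *: ej i)) 0 l <->
  has_pderiv h i x /\ pderiv h i x = l.
Proof.
rewrite /has_pderiv /pderiv derive1E; split; first by move=> /is_derive_slope[].
by move=> [d <-]; apply/is_derive_slope/derivableP.
Qed.

Lemma has_slope_line h x u (s l : R) :
  has_slope (fun t => h ((x + s *: u) + t *: u)) 0 l <-> has_slope (fun t => h (x + t *: u)) s l.
Proof.
rewrite -[X in _ <-> has_slope _ X _]add0r -has_slope_shift.
by under [X in _ <-> has_slope X _ _]eq_fun do rewrite scalerDl addrA addrAC.
Qed.

Lemma norm2_mono u v : (forall j, `|u j 0| <= `|v j 0|) -> norm2 u <= norm2 v.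
Proof.
move=> H; apply: norm2_le_sqr (norm2_ge0 _) _; rewrite sqr_norm2; apply: ler_sum => j _.
by rewrite -[leLHS]real_normK ?num_real // -[leRHS]real_normK ?num_real // lerXn2r ?nnegrE.
Qed.

Definition head_part k u : V := \col_i (if (i < k)%N then u i 0 else 0).

(* Go from [x] to [x + u] one coordinate at a time. *)
Lemma increment_bound h x (r e : R) (a : 'I_N -> R) :
  (forall i z, norm2 (z - x) < r -> has_pderiv h i z /\ `|pderiv h i z - a i| <= e) ->
  forall u, norm2 u < r -> `|h (x + u) - h x - \sum_i u i 0 * a i| <= e * \sum_i `|u i 0|.
Proof.
move=> H u ur.
suff main k : (k <= N)%N -> `|h (x + head_part k u) - h x - \sum_(i < N | (i < k)%N) u i 0 * a i|
    <= e * \sum_(i < N | (i < k)%N) `|u i 0|.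
  have := main N (leqnn N); have -> : head_part N u = u.
    by apply/matrixP => i j; rewrite mxE ltn_ord ord1.
  rewrite (eq_bigl predT) => [|i]; last by rewrite ltn_ord.
  by rewrite [X in _ <= e * X -> _](eq_bigl predT) => [//|i]; rewrite ltn_ord.
elim: k => [_|k IH kN].
  have -> : head_part 0 u = 0 by apply/matrixP => i j; rewrite !mxE.
  by rewrite addr0 subrr !big_pred0 // subr0 mulr0 normr0.
pose i0 := Ordinal kN.
have sumS (A : 'I_N -> R) : \sum_(i < N | (i < k.+1)%N) A i = A i0 + \sum_(i < N | (i < k)%N) A i.
  rewrite (bigD1 i0) //=; congr (_ + _); apply: eq_bigl => i.
  by rewrite ltnS ltn_neqAle andbC -(inj_eq val_inj).
have headS : head_part k.+1 u = head_part k u + u i0 0 *: ej i0.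
  apply/matrixP => i j; rewrite !mxE ltnS leq_eqVlt ord1 eqxx andbT.
  rewrite -[(i == k :> nat)]/(val i == val i0) (inj_eq val_inj).
  have [->|_] := eqVneq i i0; first by rewrite ltnn mulr1 add0r.
  by rewrite mulr0 addr0.
rewrite !sumS headS mulrDr addrA.
set y := x + head_part k u.
(* Subtracting the linear term makes the slope of [g] the deviation of the partial derivative from
   [a i0], which [e] bounds. *)
pose g t := h (y + t *: ej i0) - t * a i0.
(* The points on this edge differ from [x] by a vector dominated by [u] in every coordinate, so they
   stay in the ball. *)
have Hy t : `|t - 0| <= `|u i0 0 - 0| -> norm2 (y + t *: ej i0 - x) < r.
  rewrite !subr0 => tu; apply: le_lt_trans ur; apply: norm2_mono => j.
  rewrite /y !mxE eqxx andbT addrAC [x j 0 + _]addrC addrK.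
  have [->|ji] := eqVneq j i0; first by rewrite ltnn add0r mulr1.
  by rewrite mulr0 addr0; case: ifP; rewrite ?normr0.
have gb : `|g (u i0 0) - g 0| <= e * `|u i0 0 - 0|.
  apply: (@mean_value_bound _ g (fun t => pderiv h i0 (y + t *: ej i0) - a i0)) => t tu.
    apply: has_slopeB.
      by apply/has_slope_line/pderivP; split=> //; case: (H i0 _ (Hy t tu)).
    by have := has_slopeZ (a i0) (has_slope_id t); rewrite mulr1; apply: has_slope_ext => s;
       rewrite mulrC.
  by case: (H i0 _ (Hy t tu)).
have := IH (ltnW kN); rewrite -/y.
move: gb; rewrite /g scale0r addr0 mul0r subr0 subr0 => gb IHk.
have -> : forall S1 : R, h (y + u i0 0 *: ej i0) - h x - (u i0 0 * a i0 + S1) =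
  (h (y + u i0 0 *: ej i0) - u i0 0 * a i0 - h y) + (h y - h x - S1) by move=> *; ring.
by apply: le_trans (ler_normD _ _) _; apply: lerD.
Qed.

Definition norm2_open U := forall x, U x -> exists2 r : R, 0 < r & forall z, norm2 (z - x) < r -> U z.

Definition C1on U h :=
  forall i x, U x -> has_pderiv h i x /\ cont_at (pderiv h i) x.

(** Continuous partial derivatives give total differentiability; the sum of absolute values is the
    length of the coordinate path. *)
Lemma C1on_increment U h x (e : R) : norm2_open U -> C1on U h -> U x -> 0 < e ->
  exists2 r, 0 < r & forall u, norm2 u < r ->
    `|h (x + u) - h x - \sum_i u i 0 * pderiv h i x| <= e * \sum_i `|u i 0|.
Proof.
move=> oU H Ux e0; have [r0 r00 Hr0] := oU x Ux.
have [r r_gt0 Hr] : exists2 r, 0 < r &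
    forall i z, norm2 (z - x) < r -> `|pderiv h i z - pderiv h i x| <= e.
  apply: fin_radius => [i r r' rr' h1 z zr|i]; first exact/h1/(lt_le_trans zr).
  have [_ /(_ e e0)[r r_gt0 Hr]] := H i x Ux; exists r => // z zr; exact/ltW/Hr.
exists (Num.min r0 r); first by rewrite lt_min r00.
apply: increment_bound => i z; rewrite lt_min => /andP[z0 zr].
by split; [case: (H i z (Hr0 z z0)) | apply: Hr].
Qed.

Lemma C1on_slope U h x b : norm2_open U -> C1on U h -> U x ->
  has_slope (fun t => h (x + t *: b)) 0 (\sum_i b i 0 * pderiv h i x).
Proof.
move=> oU H Ux e e0.
(* [B] dominates the coordinate sum, for the error, and [norm2 b], for the radius; the 1 covers
   [b = 0]. *)
pose B := \sum_i `|b i 0| + norm2 b + 1.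
have S0 : 0 <= \sum_i `|b i 0| by rewrite sumr_ge0.
have B0 : 0 < B by rewrite /B; have := norm2_ge0 b; lra.
have [r r0 Hr] := C1on_increment oU H Ux (divr_gt0 e0 B0).
exists (r / B) => [|t]; first exact: divr_gt0.
rewrite ltr_pdivlMr // => tr; rewrite add0r scale0r addr0.
have -> : t * (\sum_i b i 0 * pderiv h i x) = \sum_i (t *: b) i 0 * pderiv h i x.
  by rewrite mulr_sumr; apply: eq_bigr => i _; rewrite mxE mulrA.
have := Hr (t *: b); rewrite norm2Z => Hb; apply: le_trans (Hb _) _.
- by apply: le_lt_trans tr; rewrite ler_wpM2l // /B; lra.
- rewrite (eq_bigr (fun i => `|t| * `|b i 0|)) => [|i _]; last by rewrite mxE normrM.
  rewrite -mulr_sumr mulrCA mulrC ler_wpM2r // -mulrA ler_piMr ?ltW //.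
  by rewrite mulrC ltr_pdivrMr // mul1r /B; have := norm2_ge0 b; lra.
Qed.

Lemma Ck_cont k U h x : Ck k U h -> U x -> cont_at h x.
Proof. by case: k => [|k] [H _]; apply: H. Qed.

Lemma Ck_C1on k U h : Ck k.+1 U h -> C1on U h.
Proof.
move=> [_ H] i x Ux; have [Hd HC] := H i; split; first exact: Hd.
exact: Ck_cont HC Ux.
Qed.

(** The iterated directional derivative [(b . grad)^q h] at [x]. Differentiating [h] innermost lets
    [Ck k.+1] pass to [Ck k] of the partial derivatives in inductions on [q]. *)
Fixpoint dirn q b h x : R :=
  if q is q'.+1 then \sum_i b i 0 * dirn q' b (pderiv h i) x else h x.

Lemma dirn_slope q k U h x b : norm2_open U -> Ck k U h -> (q < k)%N -> U x ->
  has_slope (fun t => dirn q b h (x + t *: b)) 0 (dirn q.+1 b h x).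
Proof.
move=> oU; elim: q k h => [|q IH] [//|k] h Hk qk Ux.
  exact: (C1on_slope b oU (Ck_C1on Hk) Ux).
rewrite [dirn q.+2 _ _ _]/=; apply: has_slope_sum => i; apply: has_slopeZ.
by case: Hk => _ /(_ i)[_ Hi]; exact: (IH k _ Hi qk Ux).
Qed.

(** Continuity handles [q = 0]; each further order is a sum of [N] terms with coefficients at most
    1. Using [M] both as bound and as inverse radius lets [fin_bound] treat all partial derivatives
    at once. *)
Lemma dirn_bounded q k U h x0 : Ck k U h -> (q <= k)%N -> U x0 ->
  exists2 M, 0 < M & forall x b, norm2 (x - x0) < M^-1 -> norm2 b <= 1 -> `|dirn q b h x| <= M.
Proof.
elim: q k h => [|q IH] k h Hk qk Ux.
  have [r r0 Hr] := Ck_cont Hk Ux ltr01.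
  exists (Num.max r^-1 (`|h x0| + 1)) => [|x b xr _ /=].
    by rewrite lt_max invr_gt0 r0.
  rewrite le_max; apply/orP; right; rewrite -lerBlDl (le_trans (lerB_dist _ _)) //.
  apply/ltW/Hr/(lt_le_trans xr); rewrite -[leRHS]invrK lef_pV2 ?posrE ?invr_gt0 //.
    by rewrite le_max lexx.
  by rewrite lt_max invr_gt0 r0.
case: k Hk qk => // k [_ Hk] qk.
have [M M0 HM] : exists2 M, 0 < M & forall i : 'I_N, 0 < M /\ forall x b, norm2 (x - x0) < M^-1 ->
    norm2 b <= 1 -> `|dirn q b (pderiv h i) x| <= M.
  apply: fin_bound => [i M M' MM' [M0 H]|i].
    split=> [|x b xr b1]; first exact: lt_le_trans MM'.
    apply: (le_trans _ MM'); apply: H => //; apply: (lt_le_trans xr).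
    by rewrite lef_pV2 ?posrE //; apply: lt_le_trans MM'.
  by have [_ Hi] := Hk i; have [M M0 HM] := IH k _ Hi qk Ux; exists M.
(* With [N.+1] instead of [N] the new constant is positive even for [N = 0], and its inverse is a
   smaller radius. *)
have MN : M <= N.+1%:R * M by rewrite ler_peMl ?ler1n // ltW.
exists (N.+1%:R * M) => [|x b xr b1 /=]; first by rewrite mulr_gt0.
apply: le_trans (ler_norm_sum _ _ _) _.
apply: le_trans (ler_sum _ (_ : forall i, true -> _ <= M)) _.
  move=> i _; rewrite normrM -[M]mul1r; apply: ler_pM => //.
    exact: le_trans (coord_le_norm2 _ _) b1.
  have [_ H] := HM i; apply: H => //; apply: (lt_le_trans xr).
  by rewrite lef_pV2 ?posrE // mulr_gt0.
by rewrite sumr_const card_ord -[leLHS]mulr_natl ler_wpM2r ?ler_nat // ltW.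
Qed.

(** This is [increment_bound] around [x] with all reference slopes 0, a local bound on the partial
    derivatives playing the role of [e]. *)
Lemma C1on_lipschitz U h x0 : norm2_open U -> C1on U h -> U x0 ->
  exists2 L, 0 < L & forall x y, norm2 (x - x0) < L^-1 -> norm2 (y - x0) < L^-1 ->
    `|h y - h x| <= L * norm2 (y - x).
Proof.
move=> oU H Ux; have [r0 r00 Hr0] := oU x0 Ux.
have [M M0 HM] : exists2 M, 0 < M & forall i : 'I_N, 0 < M /\ forall z, norm2 (z - x0) < M^-1 ->
    `|pderiv h i z| <= M.
  apply: fin_bound => [i M M' MM' [M0 H1]|i].
    split=> [|z zr]; first exact: lt_le_trans MM'.
    apply: (le_trans _ MM'); apply: H1 => //; apply: (lt_le_trans zr).
    by rewrite lef_pV2 ?posrE //; apply: lt_le_trans MM'.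
  have [_ /(_ 1 ltr01)[r r_gt0 Hr]] := H i x0 Ux.
  have mx : 0 < Num.max r^-1 (`|pderiv h i x0| + 1) by rewrite lt_max invr_gt0 r_gt0.
  exists (Num.max r^-1 (`|pderiv h i x0| + 1)) => //; split=> // z zr.
  rewrite le_max; apply/orP; right; rewrite -lerBlDl (le_trans (lerB_dist _ _)) //.
  apply/ltW/Hr/(lt_le_trans zr); rewrite -[leRHS]invrK lef_pV2 ?posrE ?invr_gt0 //.
  by rewrite le_max lexx.
pose r := Num.min r0 M^-1.
have r_gt0 : 0 < r by rewrite lt_min r00 invr_gt0.
pose L := Num.max (3 * r^-1) (N.+1%:R * M).
have L0 : 0 < L by rewrite lt_max mulr_gt0 ?invr_gt0.
(* [x] lies within [L^-1] of [x0] and the increment is shorter than [2 * L^-1], so every point used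
   is within [3 * L^-1] of [x0]. *)
have L3 : 3 * L^-1 <= r.
  have : 3 * r^-1 <= L by rewrite le_max lexx.
  by rewrite -ler_pdivlMr ?invr_gt0 // invrK => h1; rewrite ler_pdivrMr // mulrC.
exists L => // x y xr yr.
have xyr : norm2 (y - x) < 2 * L^-1.
  by apply: le_lt_trans (ler_norm2_dist x0 _ _) _; rewrite (norm2_distC x0); lra.
have := @increment_bound h x (2 * L^-1) M (fun=> 0) _ (y - x) xyr.
have -> : x + (y - x) = y by rewrite addrC subrK.
rewrite big1 => [|i _]; last by rewrite mulr0.
rewrite subr0 => Hb; apply: le_trans (Hb _) _.
  move=> i z zr; have : norm2 (z - x0) < r.
    by apply: le_lt_trans (ler_norm2_dist x _ _) _; lra.
  rewrite lt_min => /andP[z0 zM]; rewrite subr0.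
  by split; [case: (H i z (Hr0 z z0)) | case: (HM i) => _; apply].
apply: le_trans (_ : N%:R * M * norm2 (y - x) <= _).
  by rewrite [leRHS]mulrAC [leLHS]mulrC ler_wpM2r ?(ltW M0) // sum_le_norm2.
rewrite ler_wpM2r ?norm2_ge0 // le_max; apply/orP; right.
by rewrite ler_wpM2r ?ler_nat // ltW.
Qed.

Lemma norm2_open_ball x0 (r : R) : norm2_open [set x | norm2 (x - x0) < r]%classic.
Proof.
move=> x /= xr; exists (r - norm2 (x - x0)) => [|z zr]; first by rewrite subr_gt0.
by apply: le_lt_trans (ler_norm2_dist x _ _) _; rewrite -ltrBrDr.
Qed.

End Partials.

(** * Quantitative local inverse and the extrapolation error *)

Section LocalInverse.
Context {R : realType} {N : nat}.
Local Notation V := 'cV[R]_N.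
Implicit Types (G W : V -> V) (U : set V).

Lemma C1on_lipschitz_vec U G x0 : norm2_open U -> (forall j, C1on U (fun x => G x j 0)) -> U x0 ->
  exists2 L, 0 < L & forall x y, norm2 (x - x0) < L^-1 -> norm2 (y - x0) < L^-1 ->
    norm2 (G y - G x) <= L * norm2 (y - x).
Proof.
move=> oU H Ux.
have [L L0 HL] : exists2 L, 0 < L & forall j : 'I_N, 0 < L /\ forall x y,
    norm2 (x - x0) < L^-1 -> norm2 (y - x0) < L^-1 -> `|G y j 0 - G x j 0| <= L * norm2 (y - x).
  apply: fin_bound => [j L L' LL' [L0 HL]|j].
    have L'0 : 0 < L' by exact: lt_le_trans LL'.
    have Lv : L'^-1 <= L^-1 by rewrite lef_pV2 ?posrE.
    split=> // x y xr yr; apply: le_trans (HL x y _ _) _; try exact: lt_le_trans Lv.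
    by rewrite ler_wpM2r ?norm2_ge0.
  by have [L L0 HL] := C1on_lipschitz oU (H j) Ux; exists L.
have LN : L <= N.+1%:R * L by rewrite ler_peMl ?ler1n // ltW.
have Lv : (N.+1%:R * L)^-1 <= L^-1 by rewrite lef_pV2 ?posrE // mulr_gt0.
exists (N.+1%:R * L) => [|x y xr yr]; first by rewrite mulr_gt0.
apply: le_trans (_ : N%:R * (L * norm2 (y - x)) <= _).
  apply: norm2_le_const => j; rewrite !mxE; have [_ HLj] := HL j.
  by apply: HLj; apply: lt_le_trans Lv.
by rewrite -mulrA ler_wpM2r ?ler_nat // mulr_ge0 ?norm2_ge0 // ltW.
Qed.

(** Iterates live in the [rho]-ball around [ws], residuals in the [dlt]-ball around 0. A single [L]
    serves both Lipschitz estimates and the Taylor remainder of order [p.+1]. *)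
Definition local_bounds G W (ws : V) (p : nat) (rho dlt L : R) :=
  [/\ [/\ 0 < rho, 0 < dlt & 0 < L],
      forall r r', norm2 r < dlt -> norm2 r' < dlt -> norm2 (W r' - W r) <= L * norm2 (r' - r),
      forall w w', norm2 (w - ws) < rho -> norm2 (w' - ws) < rho ->
        norm2 (G w' - G w) <= L * norm2 (w' - w),
      forall w, norm2 (w - ws) < rho -> norm2 (G w) < dlt /\ W (G w) = w &
      forall j r b, norm2 r < dlt -> norm2 b <= 1 ->
        `|dirn p.+1 b (fun r => W r j 0) r| <= L].

Lemma norm2_open_ball0 (r : R) : norm2_open [set x : V | norm2 x < r]%classic.
Proof.
move=> x /= xr; have := @norm2_open_ball R N 0 r x; rewrite /= subr0 => /(_ xr)[e e0 He].
by exists e => // z /He; rewrite /= subr0.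
Qed.

Lemma local_bounds_exist G W (ws : V) (p k : nat) (delta eta : R) :
  (forall j, C1on setT (fun w => G w j 0)) ->
  0 < delta -> 0 < eta -> (p < k)%N ->
  (forall j, Ck k [set r | norm2 r < delta]%classic (fun r => W r j 0)) ->
  W 0 = ws -> (forall r, norm2 r < delta -> G (W r) = r) ->
  (forall r w, norm2 r < delta -> norm2 (w - ws) < eta -> G w = r -> w = W r) ->
  exists rho dlt L, local_bounds G W ws p rho dlt L /\ dlt <= delta.
Proof.
move=> GC delta0 eta0 pk WC W0 GW uniq.
have U0 : [set r : V | norm2 r < delta]%classic 0 by rewrite /= norm2_0.
have [L1 L10 HL1] := @C1on_lipschitz_vec setT G ws (fun x _ => ex_intro2 _ _ 1 ltr01 (fun _ _ => I)) GC I.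
have WC1 j : C1on [set r : V | norm2 r < delta]%classic (fun r => W r j 0).
  by case: k pk WC => // k _ WC; apply: Ck_C1on (WC j).
have [L2 L20 HL2] := C1on_lipschitz_vec (@norm2_open_ball0 delta) WC1 U0.
have [M M0 HM] : exists2 M, 0 < M & forall j : 'I_N, 0 < M /\ forall r b, norm2 (r - 0) < M^-1 ->
    norm2 b <= 1 -> `|dirn p.+1 b (fun r => W r j 0) r| <= M.
  apply: fin_bound => [j M M' MM' [M0 H]|j].
    have M'0 : 0 < M' by exact: lt_le_trans MM'.
    split=> // r b rr b1; apply: (le_trans (H _ _ _ b1) MM').
    by apply: lt_le_trans rr _; rewrite lef_pV2 ?posrE.
  by have [M M0 HM] := dirn_bounded (WC j) pk U0; exists M.
pose dlt := Num.min delta (Num.min L2^-1 M^-1).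
have dlt0 : 0 < dlt by rewrite !lt_min delta0 !invr_gt0 L20 M0.
(* [eta] gives uniqueness, [L1^-1] the Lipschitz bound of [G], and [dlt / L1] makes [G] map into the
   [dlt]-ball because [G ws = 0]. *)
pose rho := Num.min eta (Num.min L1^-1 (dlt / L1)).
have rho0 : 0 < rho by rewrite !lt_min eta0 invr_gt0 L10 divr_gt0.
exists rho, dlt, (Num.max L1 (Num.max L2 M)); split; last by rewrite ge_min lexx.
have ltrho (w : V) : norm2 (w - ws) < rho ->
    [/\ norm2 (w - ws) < eta, norm2 (w - ws) < L1^-1 & norm2 (w - ws) < dlt / L1].
  by rewrite !lt_min => /andP[-> /andP[-> ->]].
have ltdlt (r : V) : norm2 r < dlt -> [/\ norm2 r < delta, norm2 r < L2^-1 & norm2 r < M^-1].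
  by rewrite !lt_min => /andP[-> /andP[-> ->]].
have Gws : G ws = 0 by rewrite -W0 GW // norm2_0.
split=> [|r r' /ltdlt[_ rL _] /ltdlt[_ rL' _]|w w' /ltrho[_ wL _] /ltrho[_ wL' _]|w wr|j r b /ltdlt[_ _ rM] b1].
- by rewrite !lt_max L10.
- apply: le_trans (HL2 _ _ _ _) _; rewrite ?subr0 //.
  by rewrite ler_wpM2r ?norm2_ge0 // !le_max lexx !orbT.
- apply: le_trans (HL1 _ _ _ _) _ => //.
  by rewrite ler_wpM2r ?norm2_ge0 // !le_max lexx.
- have [weta wL wd] := ltrho w wr.
  have Gd : norm2 (G w) < dlt.
    have := HL1 ws w; rewrite subrr norm2_0 invr_gt0 => /(_ L10 wL).
    rewrite Gws subr0 => /le_lt_trans; apply.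
    by move: wd; rewrite ltr_pdivlMr // mulrC.
  split=> //; apply/esym/uniq => //; by case: (ltdlt _ Gd).
- have [_ HMj] := HM j; apply: le_trans (HMj _ _ _ b1) _; first by rewrite subr0.
  by rewrite !le_max lexx !orbT.
Qed.

(* A kernel vector [u] of the Jacobian would give [G (w + t u) = G w + o(t)], hence
   [t u = o(t)] through the Lipschitz inverse [W]. *)
Lemma jacobian_unit G W (ws : V) p (rho dlt L : R) (G' : V -> V) (a w : V) :
  local_bounds G W ws p rho dlt L ->
  (forall j, C1on setT (fun w => G' w j 0)) -> (forall w, G' w = G w - a) ->
  norm2 (w - ws) < rho ->
  (\matrix_(i, j) pderiv (fun w' => G' w' i 0) j w) \in unitmx.
Proof.
move=> [[rho0 dlt0 L0] WL _ GWb _] GC GE wr.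
set A := \matrix_(_, _) _; apply/negPn/negP => NA.
have : \det A^T == 0 by move: NA; rewrite unitmxE unitfE negbK det_tr.
move=> /det0P[v v0 vA]; set u : V := v^T.
have Au i : \sum_j u j 0 * pderiv (fun w' => G' w' i 0) j w = 0.
  have := congr1 (fun M : 'rV[R]_N => M 0 i) vA; rewrite mxE [RHS]mxE => E; rewrite -[RHS]E.
  by apply: eq_bigr => j _; rewrite !mxE.
suff /eqP : norm2 u = 0.
  by move=> /eqP/norm2_eq0 u0; move/negP: v0; apply; rewrite -[v]trmxK -/u u0 trmx0.
(* The slope error [e] is the small variable: [norm2 u <= L * N * e] for every [e] in (0, 1). *)
apply: (@eq0_of_small _ _ (L * N%:R) 1) => // e e0 _.
have oT : @norm2_open R N setT by move=> x _; exists 1.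
pose small (i : 'I_N) (r : R) := forall tau : R, `|tau| < r ->
    `|G' (w + tau *: u) i 0 - G' w i 0| <= e * `|tau|.
have [r r0 Hr] : exists2 r, 0 < r & forall i, small i r.
  apply: (@fin_radius _ _ small) => [i r r' rr' H tau taur|i]; first exact: H (lt_le_trans taur rr').
  have [r r0 Hr] := C1on_slope (x := w) u oT (GC i) I e0; exists r => // tau /Hr.
  by rewrite Au mulr0 subr0 add0r scale0r addr0.
have u0 := norm2_ge0 u.
have g0 : 0 < rho - norm2 (w - ws) by rewrite subr_gt0.
(* Small enough both for the slope estimate and for [w + tau u] to remain in the [rho]-ball. *)
pose tau := Num.min (r / 2) ((rho - norm2 (w - ws)) / (2 * (norm2 u + 1))).
have tau0 : 0 < tau by rewrite lt_min !divr_gt0 // mulr_gt0 // ltr_wpDl.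
have taur : tau < r by rewrite gt_min ltr_pdivrMr //; apply/orP; left; lra.
have wtr : norm2 (w + tau *: u - ws) < rho.
  have : tau <= (rho - norm2 (w - ws)) / (2 * (norm2 u + 1)) by rewrite ge_min lexx orbT.
  rewrite ler_pdivlMr ?mulr_gt0 ?ltr_wpDl // => tb.
  rewrite addrAC; apply: le_lt_trans (ler_norm2D _ _) _.
  rewrite norm2Z gtr0_norm //; nra.
have [Gd1 GW1] := GWb _ wtr; have [Gd2 GW2] := GWb _ wr.
have := WL _ _ Gd2 Gd1; rewrite GW1 GW2 addrAC subrr add0r norm2Z (gtr0_norm tau0) => Hu.
rewrite (ger0_norm u0) -(ler_pM2l tau0); apply: le_trans Hu _.
have -> : G (w + tau *: u) - G w = G' (w + tau *: u) - G' w.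
  by rewrite !GE opprB addrA subrK.
have -> : tau * (L * N%:R * e) = L * (N%:R * (e * tau)) by ring.
rewrite ler_wpM2l ?(ltW L0) //; apply: norm2_le_const => i; rewrite !mxE.
by rewrite -{2}(gtr0_norm tau0) Hr // gtr0_norm.
Qed.

(* [P] agrees to order [p] at [s] with the exact curve [t |-> W (a + t b)], so it is
   its Taylor polynomial there. *)
Lemma extrapolation_error G W (ws : V) p k (delta rho dlt L : R) (w a b : V) (s : R)
    (v : nat -> V) (C dl : R) :
  local_bounds G W ws p rho dlt L -> dlt <= delta -> (p < k)%N ->
  (forall j, Ck k [set r | norm2 r < delta]%classic (fun r => W r j 0)) ->
  norm2 (w - ws) < rho -> norm2 b <= 1 -> 0 <= s -> G w = a + s *: b ->
  norm2 a + 2 * s < dlt ->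
  let P x := w + \sum_(1 <= q < p.+1) (((x - s) ^+ q) / q`!%:R) *: v q in
  0 < dl ->
  (forall x, `|x - s| < dl -> norm2 (G (P x) - a - x *: b) <= C * `|x - s| ^+ p.+1) ->
  norm2 (P 0 - W a) <= N%:R * (L * s ^+ p.+1).
Proof.
move=> [[rho0 dlt0 L0] WL _ GWb Wd] dd pk WC wr b1 s0 Gw asd P dl0 HP.
apply: norm2_le_const => j.
pose g q t := dirn q b (fun r => W r j 0) (a + t *: b).
pose T x := \sum_(0 <= q < p.+1) g q s * ((x - s) ^+ q / q`!%:R).
have b0 := norm2_ge0 b.
(* At [x = 0] the premise reads [norm2 a + 2 * s < dlt]: the whole segment from [s] down to 0 must
   stay in the domain of [W]. *)
have inb x t : norm2 a + s + `|x - s| < dlt -> `|t - s| <= `|x - s| -> norm2 (a + t *: b) < dlt.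
  move=> xd ts; apply: le_lt_trans (ler_norm2D _ _) _; rewrite norm2Z.
  have : `|t| <= s + `|t - s|.
    by apply: le_trans (_ : `|s + (t - s)| <= _); [rewrite addrC subrK | rewrite (le_trans (ler_normD _ _)) // ger0_norm].
  have := normr_ge0 t; nra.
have tay x : norm2 a + s + `|x - s| < dlt -> `|W (a + x *: b) j 0 - T x| <= L * `|x - s| ^+ p.+1.
  move=> xd; apply: (@taylor_bound _ p g) => [q t qp ts|t ts].
    apply/(@has_slope_line _ _ (dirn q b (fun r => W r j 0))).
    apply: (dirn_slope b (@norm2_open_ball0 delta) (WC j)); first exact: leq_ltn_trans pk.
    by rewrite /=; apply: lt_le_trans dd; apply: inb ts.
  by apply: Wd => //; apply: inb ts.
(* [P] has no coefficient [v 0]; putting [w] there gives it the same shape as [T]. *)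
pose v' q := if q is 0%N then w else v q.
have PE x : P x j 0 = \sum_(0 <= q < p.+1) v' q j 0 * ((x - s) ^+ q / q`!%:R).
  rewrite /P mxE summxE [RHS]big_ltn //= expr0 fact0 divr1 mulr1; congr (_ + _).
  by apply: eq_big_nat => q /andP[q1 _]; rewrite mxE mulrC; case: q q1.
have PT x : P x j 0 = T x.
  suff coef q : (q < p.+1)%N -> (v' q j 0 - g q s) / q`!%:R = 0.
    rewrite PE; apply: eq_big_nat => q /andP[_ /coef /eqP].
    by rewrite mulf_eq0 invr_eq0 pnatr_eq0 -[_ == 0%N]negbK -lt0n fact_gt0 orbF subr_eq0 => /eqP ->.
  pose S := \sum_(1 <= q < p.+1) norm2 (v q).
  have S0 : 0 <= S by rewrite sumr_ge0 // => i _; exact: norm2_ge0.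
  have S1 : 0 < S + 1 by rewrite ltr_wpDl.
  pose g1 := rho - norm2 (w - ws); pose g2 := dlt - (norm2 a + s).
  have g10 : 0 < g1 by rewrite subr_gt0.
  have g20 : 0 < g2 by rewrite /g2; lra.
  (* For small [t] the point [P (s + t)] is in the [rho]-ball, where [W] undoes [G]: the residual
     hypothesis yields [L * C * t^(p+1)] and the Taylor remainder [L * t^(p+1)]. The four radii
     serve the hypothesis on [P], [t^q <= t], the domain of [W], and the [rho]-ball. *)
  apply: (@poly_small_eq0 _ _ (fun q => (v' q j 0 - g q s) / q`!%:R) (L * C + L)
     (Num.min (Num.min dl 1) (Num.min g2 (g1 / (S + 1))))).
    by rewrite !lt_min dl0 ltr01 g20 divr_gt0.
  move=> t t0; rewrite !lt_min => /andP[/andP[tdl t1] /andP[tg2]].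
  rewrite ltr_pdivlMr // => tg1.
  have ts : `|s + t - s| = t by rewrite addrAC subrr add0r gtr0_norm.
  have xd : norm2 a + s + `|s + t - s| < dlt by rewrite ts; move: tg2; rewrite /g2; lra.
  have -> : \sum_(0 <= q < p.+1) (v' q j 0 - g q s) / q`!%:R * t ^+ q =
      P (s + t) j 0 - T (s + t).
    rewrite PE /T -sumrB; apply: eq_bigr => i _.
    by rewrite addrAC subrr add0r; ring.
  have Pr : norm2 (P (s + t) - ws) < rho.
    apply: le_lt_trans (ler_norm2_dist w _ _) _.
    suff : norm2 (P (s + t) - w) <= t * S by move: tg1; rewrite /g1; lra.
    rewrite /P addrAC subrr add0r (addrAC s) subrr add0r.
    apply: le_trans (norm2_sum _ _ _) _; rewrite mulr_sumr.
    rewrite [leLHS]big_nat_cond [leRHS]big_nat_cond.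
    apply: ler_sum => i; rewrite andbT => /andP[i1 _].
    rewrite norm2Z ler_wpM2r ?norm2_ge0 // ger0_norm ?divr_ge0 ?exprn_ge0 ?ler0n ?(ltW t0) //.
    rewrite ler_pdivrMr ?ltr0n ?fact_gt0 //; case: i i1 => // i _.
    have tq : t ^+ i <= 1 by rewrite exprn_ile1 // ltW.
    have f1 : (1 : R) <= (i.+1)`!%:R by rewrite ler1n fact_gt0.
    by rewrite exprS ler_pM2l // (le_trans tq).
  have [Gd GWP] := GWb _ Pr.
  have near : `|P (s + t) j 0 - W (a + (s + t) *: b) j 0| <= L * (C * t ^+ p.+1).
    rewrite -{1}GWP.
    have -> : forall A B : V, A j 0 - B j 0 = (A - B) j 0 by move=> A B; rewrite !mxE.
    apply: le_trans (coord_le_norm2 _ _) _.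
    apply: le_trans (WL _ _ _ Gd) _; first by apply: inb xd _.
    rewrite ler_wpM2l ?(ltW L0) // opprD addrA.
    by have := HP (s + t); rewrite ts; apply.
  have := tay _ xd; rewrite ts => far.
  rewrite -(subrKA (W (a + (s + t) *: b) j 0)) mulrDl -mulrA.
  by apply: le_trans (ler_normD _ _) _; apply: lerD.
(* Since [P = T] as polynomials, only the Taylor remainder at distance [s] is left: [C] and [dl]
   disappear, and [P 0] need not be known to lie near [ws]. *)
rewrite mxE [(- W a) j 0]mxE PT distrC.
by have := tay 0; rewrite scale0r addr0 sub0r normrN ger0_norm //; apply; lra.
Qed.

End LocalInverse.

(** * Transfer of convergence orders from the barrier parameter *)

Section Rates.
Context {R : realType}.
Implicit Types (u mu : nat -> R) (kappa l : R).

(** Factor [x^q] as [x^(q - kappa) * x^kappa]; [m0] is the point where the first factor equals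
    [B / (|A| + 1)]. *)
Lemma monomial_small kappa (q : nat) (A B : R) : kappa < q%:R -> 0 < B ->
  exists2 m0, 0 < m0 & forall x, 0 < x -> x <= m0 -> A * x ^+ q <= B * x `^ kappa.
Proof.
move=> kq B0; have a0 : 0 < q%:R - kappa by rewrite subr_gt0.
have A0 : 0 < `|A| + 1 by rewrite ltr_wpDl.
have e0 : 0 < B / (`|A| + 1) by rewrite divr_gt0.
exists ((B / (`|A| + 1)) `^ (q%:R - kappa)^-1); first exact: powR_gt0.
move=> x x0 xm.
have xa : x `^ (q%:R - kappa) <= B / (`|A| + 1).
  apply: le_trans (ge0_ler_powR (ltW a0) _ _ xm) _; rewrite ?nnegrE ?powR_ge0 ?(ltW x0) //.
  by rewrite -powRrM mulVf ?gt_eqF // powRr1 // ltW.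
rewrite -powR_mulrn ?(ltW x0) // -{1}(subrK kappa q%:R) powRD; last by rewrite (gt_eqF x0) implybT.
rewrite mulrA ler_wpM2r ?powR_ge0 //.
move: xa; rewrite ler_pdivlMr // => xa.
have := powR_ge0 x (q%:R - kappa); have := ler_norm A; nra.
Qed.

Lemma seq_cvg0_le mu (m0 : R) : seq_cvg mu 0 -> 0 < m0 ->
  exists K, forall k, (K <= k)%N -> mu k <= m0.
Proof.
move=> H m00; have [K HK] := H m0 m00; exists K => k /HK; rewrite subr0 => h.
exact/ltW/(le_lt_trans (ler_norm _)).
Qed.

(* With [gam] large, [gam * mu k.+1 <= (gam * mu k) `^ kappa], so the constants
   [c2] and [C] disappear. *)
Lemma R_order mu u kappa l (c2 C : R) K : 1 < kappa -> 0 < c2 -> 0 < C ->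
  (forall k, 0 < mu k) -> seq_cvg mu 0 ->
  (forall k, (K <= k)%N -> mu k.+1 <= c2 * mu k `^ kappa) ->
  (forall k, (K <= k)%N -> `|u k.+1 - l| <= C * mu k) -> Rconv kappa u l.
Proof.
move=> k1 c20 C0 mu0 mucv Hmu Hu.
have ka0 : 0 < kappa by lra.
have k10 : 0 < kappa - 1 by lra.
pose gam := Num.max C (c2 `^ (kappa - 1)^-1).
have gam0 : 0 < gam by rewrite lt_max C0.
have gamC : C <= gam by rewrite le_max lexx.
have gamc : c2 <= gam `^ (kappa - 1).
  have := @ge0_ler_powR R (kappa - 1) (ltW k10) (c2 `^ (kappa - 1)^-1) gam.
  rewrite -powRrM mulVf ?gt_eqF // powRr1 ?(ltW c20) // !nnegrE powR_ge0 (ltW gam0).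
  by apply=> //; rewrite le_max lexx orbT.
have [K1 HK1] : exists K1, forall k, (K1 <= k)%N -> mu k <= (2 * gam)^-1.
  by apply: seq_cvg0_le => //; rewrite invr_gt0 mulr_gt0.
pose K' := maxn K K1.
have gm0 k : 0 < gam * mu k by rewrite mulr_gt0.
have gm1 : gam * mu K' < 1.
  have := HK1 K' (leq_maxr _ _); rewrite invfM ler_pdivlMr // => h.
  by rewrite mulrC; apply: le_lt_trans h _; rewrite invf_lt1 //; lra.
have kap k : 0 < kappa ^+ k by rewrite exprn_gt0.
(* The root makes the first instance of [main] an equality. The exponent is [K'.+1] because [mu k]
   controls [u k.+1]. *)
pose beta := (gam * mu K') `^ (kappa ^+ K'.+1)^-1.
have beta0 : 0 < beta by rewrite powR_gt0.
exists beta, K'.+1; split=> //; split.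
  have := @gt0_ltr_powR R (kappa ^+ K'.+1)^-1; rewrite invr_gt0 => /(_ (kap _)) h.
  have := h (gam * mu K') 1; rewrite !nnegrE ler01 (ltW (gm0 _)) powR1.
  by apply.
have main k : gam * mu (K' + k)%N <= beta `^ (kappa ^+ (K' + k).+1).
  elim: k => [|k IH].
    by rewrite addn0 -powRrM mulVf ?gt_eqF // powRr1 // ltW.
  have KK : (K <= K' + k)%N by rewrite (leq_trans (leq_maxl K K1)) // leq_addr.
  rewrite addnS exprSr powRrM.
  apply: le_trans (ge0_ler_powR (ltW ka0) _ _ IH); rewrite ?nnegrE ?powR_ge0 ?(ltW (gm0 _)) //.
  apply: le_trans (_ : gam * (c2 * mu (K' + k)%N `^ kappa) <= _).
    by rewrite ler_pM2l // Hmu.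
  rewrite powRM ?(ltW gam0) ?(ltW (mu0 _)) // mulrA ler_wpM2r ?powR_ge0 //.
  by rewrite -(mulr_powRB1 (ltW gam0) ka0) ler_pM2l.
case=> // k; rewrite ltnS => K'k.
have KK : (K <= k)%N by rewrite (leq_trans (leq_maxl K K1)).
apply: le_trans (Hu k KK) _; have := main (k - K')%N; rewrite subnKC // => h.
by apply: le_trans h; rewrite ler_wpM2r // ltW.
Qed.

(** Errors comparable to [mu] from both sides inherit its order: the lower bound replaces [mu k] by
    [a^-1] times the error. *)
Lemma Q_order mu u kappa l (c2 C a : R) K : 0 < kappa -> 0 <= c2 -> 0 < a -> 0 < C ->
  (forall k, 0 < mu k) -> seq_cvg mu 0 ->
  (forall k, (K <= k)%N -> mu k.+1 <= c2 * mu k `^ kappa) ->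
  (forall k, (K <= k)%N -> `|u k.+1 - l| <= C * mu k) ->
  (forall k, (K <= k)%N -> a * mu k <= `|u k.+1 - l|) -> Qconv kappa u l.
Proof.
move=> k1 c20 a0 C0 mu0 mucv Hmu Hu Hl; split.
  move=> e e0; have e0' : 0 < e / (2 * C) by rewrite divr_gt0 // mulr_gt0.
  have [K1 HK1] := seq_cvg0_le mucv e0'.
  exists (maxn K K1).+1; case=> // k; rewrite ltnS geq_max => /andP[Kk K1k].
  apply: le_lt_trans (Hu k Kk) _; have := HK1 k K1k.
  by rewrite ler_pdivlMr ?mulr_gt0 // => h; have := mu0 k; nra.
exists (C * c2 * a^-1 `^ kappa), K.+1; case=> // k; rewrite ltnS => Kk.
apply: le_trans (Hu k.+1 (leqW Kk)) _; rewrite -!mulrA ler_pM2l //.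
apply: le_trans (Hmu k Kk) _; rewrite ler_wpM2l //.
rewrite -powRM ?invr_ge0 ?(ltW a0) //; apply: ge0_ler_powR; rewrite ?nnegrE ?(ltW (mu0 k)) //.
- exact: ltW.
- by rewrite mulr_ge0 // invr_ge0 ltW.
- by rewrite mulrC ler_pdivlMr // mulrC Hl.
Qed.

End Rates.

(** * The iteration near the solution *)

Section Iteration.
Context {R : realType} {N : nat}.
Local Notation V := 'cV[R]_N.
Variables (G W : V -> V) (ws bv : V) (p : nat) (rho dlt L M : R).
Hypothesis bounds : local_bounds G W ws p rho dlt L.
Hypothesis W0 : W 0 = ws.
Hypothesis GW : forall r, norm2 r < dlt -> G (W r) = r.
Variables (kappa : R) (eps : R -> R) (w wbar : nat -> V) (mu : nat -> R).
Variables (c1 c2 e1 e2 mub : R).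
Hypotheses (k1 : 1 < kappa) (k2 : kappa < p.+1%:R).
Hypotheses (M0 : 0 <= M) (c10 : 0 < c1) (c20 : 0 < c2) (e10 : 0 < e1) (e20 : 0 < e2) (mub0 : 0 < mub).
Hypothesis mu0 : forall k, 0 < mu k.
Hypothesis mucv : seq_cvg mu 0.
Hypothesis muS : forall k, mu k <= mub ->
  c1 * mu k `^ kappa <= mu k.+1 /\ mu k.+1 <= c2 * mu k `^ kappa.
Hypothesis epsE : forall k, mu k <= mub -> e1 * mu k <= eps (mu k) /\ eps (mu k) <= e2 * mu k.
Hypothesis inner : forall k, norm2 (G (w k.+1) - mu k *: bv) <= eps (mu k).
Hypothesis skip : forall k, norm2 (G (wbar k) - mu k *: bv) <= eps (mu k) -> w k.+1 = wbar k.
Hypothesis extr : forall k, norm2 (w k - ws) < rho ->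
  norm2 (mu k *: bv) + 2 * norm2 (G (w k) - mu k *: bv) < dlt ->
  norm2 (wbar k - W (mu k *: bv)) <= M * norm2 (G (w k) - mu k *: bv) ^+ p.+1.
Hypothesis sub : forall K, exists2 k, (K <= k)%N & norm2 (w k.+1 - ws) < rho.

Lemma eventual_bounds : exists C1 C2 K, [/\ 0 < C1, forall k, (K <= k)%N -> mu k <= mub &
  forall k, (K <= k)%N -> [/\ norm2 (w k.+1 - ws) <= C1 * mu k,
    norm2 (G (wbar k.+1) - mu k.+1 *: bv) <= eps (mu k.+1), w k.+2 = wbar k.+1 &
    norm2 (w k.+2 - W (mu k.+1 *: bv)) <= C2 * mu k ^+ p.+1]].
Proof.
have [[rho0 dlt0 L0] WL GL GWb _] := bounds.
pose be := norm2 bv; have be0 : 0 <= be by exact: norm2_ge0.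
(* Bounds the residual of [w k.+1] for [mu k.+1] by [C3 * mu k]: tolerance plus shift [mu k], then
   shift [mu k.+1 <= c2 * mu k]. *)
pose C3 := (e2 + be) + be * c2.
have C30 : 0 < C3 by have := mulr_ge0 be0 (ltW c20); have := e20; rewrite /C3; lra.
pose C1 := L * (e2 + be); pose C2 := M * C3 ^+ p.+1.
have C10 : 0 < C1 by rewrite /C1 mulr_gt0 //; have := e20; lra.
have C20 : 0 <= C2 by rewrite mulr_ge0 // exprn_ge0 // ltW.
(* Acceptance threshold: [L * C2 * mu_k^(p+1) <= e1 * c1 * mu_k^kappa <= e1 * mu_(k+1) <= eps
   (mu_(k+1))]. *)
have [m1 m10 Hm1] := monomial_small (L * C2) k2 (mulr_gt0 e10 c10).
pose B := be * c2 + 2 * C3; pose D := C2 + L * be * c2.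
have bc0 : 0 <= be * c2 by rewrite mulr_ge0 // ltW.
have B0 : 0 < B by rewrite /B; lra.
have D0 : 0 <= D by rewrite addr_ge0 // -mulrA mulr_ge0 // ltW.
(* [mub] and [mub / c2] validate the order bounds at [mu k] and [mu k.+1], 1 gives [mu^kappa <= mu],
   and the last two entries force [B * mu k < dlt] and [D * mu k < rho]. *)
pose m0 := Num.min (Num.min (Num.min mub (mub / c2)) (Num.min 1 m1))
  (Num.min (dlt / (2 * B)) (rho / (2 * (D + 1)))).
have m00 : 0 < m0.
  by rewrite !lt_min mub0 ltr01 m10 !divr_gt0 // mulr_gt0 // ltr_wpDl.
have [K0 HK0] := seq_cvg0_le mucv m00.
have step k : (K0 <= k)%N -> norm2 (w k.+1 - ws) < rho ->
    [/\ norm2 (w k.+1 - ws) <= C1 * mu k,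
    norm2 (G (wbar k.+1) - mu k.+1 *: bv) <= eps (mu k.+1), w k.+2 = wbar k.+1 &
    norm2 (w k.+2 - W (mu k.+1 *: bv)) <= C2 * mu k ^+ p.+1]
    /\ norm2 (w k.+2 - ws) < rho.
  move=> /HK0; rewrite !le_min => /andP[/andP[/andP[km kmc] /andP[kl1 km1]] /andP[kd kr]] wr.
  have muk := mu0 k.
  have [mul muu] := muS km; have [el eu] := epsE km.
  have mukk : mu k `^ kappa <= mu k.
    by have := @ge1r_powR R (mu k) kappa; rewrite muk kl1 => /(_ isT (ltW k1)).
  have mucc : mu k.+1 <= c2 * mu k by apply: le_trans muu _; rewrite ler_pM2l.
  have muS0 := mu0 k.+1.
  have musb : mu k.+1 <= mub.
    by apply: le_trans mucc _; move: kmc; rewrite ler_pdivlMr // mulrC.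
  have [elS _] := epsE musb.
  have kd' : 2 * (B * mu k) <= dlt by move: kd; rewrite ler_pdivlMr ?mulr_gt0 //; lra.
  have kr' : 2 * ((D + 1) * mu k) <= rho.
    by move: kr; rewrite ler_pdivlMr ?mulr_gt0 ?ltr_wpDl //; lra.
  have nmu q : norm2 (mu q *: bv) = be * mu q by rewrite norm2Z gtr0_norm // mulrC.
  have bmS : be * mu k.+1 <= be * c2 * mu k by rewrite -mulrA ler_wpM2l.
  have [Gd GWk] := GWb _ wr.
  have nG : norm2 (G (w k.+1)) <= (e2 + be) * mu k.
    rewrite -[G _](subrK (mu k *: bv)); apply: le_trans (ler_norm2D _ _) _.
    by rewrite nmu mulrDl lerD // (le_trans (inner k)).
  have ns : norm2 (G (w k.+1) - mu k.+1 *: bv) <= C3 * mu k.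
    apply: le_trans (ler_norm2B _ _) _; rewrite nmu /C3 [leRHS]mulrDl.
    exact: lerD.
  have P1 : norm2 (w k.+1 - ws) <= C1 * mu k.
    rewrite -GWk -W0; apply: le_trans (WL _ _ _ Gd) _; first by rewrite norm2_0.
    by rewrite subr0 /C1 -mulrA ler_pM2l.
  have aS : norm2 (mu k.+1 *: bv) + 2 * norm2 (G (w k.+1) - mu k.+1 *: bv) < dlt.
    rewrite nmu; have : B * mu k < dlt by have := mulr_gt0 B0 muk; lra.
    by rewrite /B; nra.
  have P4 : norm2 (wbar k.+1 - W (mu k.+1 *: bv)) <= C2 * mu k ^+ p.+1.
    apply: le_trans (extr wr aS) _; rewrite /C2 -mulrA -exprMn ler_wpM2l //.
    by rewrite lerXn2r ?nnegrE ?norm2_ge0 // mulr_ge0 // ltW.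
  have ad : norm2 (mu k.+1 *: bv) < dlt.
    by apply: le_lt_trans aS; rewrite lerDl mulr_ge0 ?norm2_ge0.
  have Wa : norm2 (W (mu k.+1 *: bv) - ws) <= L * be * c2 * mu k.
    rewrite -W0; apply: le_trans (WL _ _ _ ad) _; first by rewrite norm2_0.
    by rewrite subr0 nmu -!mulrA ler_pM2l // mulrA.
  have mup : mu k ^+ p.+1 <= mu k.
    by rewrite exprS ler_piMr ?exprn_ile1 // ltW.
  have Dm : D * mu k < rho by have := mulr_ge0 D0 (ltW muk); nra.
  have Lbc0 : 0 <= L * be * c2 * mu k.
    by rewrite -[L * _ * _]mulrA; apply: mulr_ge0 (ltW muk); apply: mulr_ge0 (ltW L0) bc0.
  have C2m : C2 * mu k ^+ p.+1 <= C2 * mu k by rewrite ler_wpM2l.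
  have Wr : norm2 (W (mu k.+1 *: bv) - ws) < rho.
    apply: le_lt_trans Wa _; apply: le_lt_trans Dm; rewrite /D mulrDl lerDr.
    by rewrite mulr_ge0 // ltW.
  have P5 : norm2 (wbar k.+1 - ws) < rho.
    apply: le_lt_trans (ler_norm2_dist (W (mu k.+1 *: bv)) _ _) _.
    apply: le_lt_trans Dm; rewrite /D mulrDl; apply: lerD Wa.
    exact: le_trans P4 C2m.
  (* As [G (W a) = a], the residual of the extrapolated point is [G] at that point minus [G] at the
     barrier point, both in the [rho]-ball. *)
  have P2 : norm2 (G (wbar k.+1) - mu k.+1 *: bv) <= eps (mu k.+1).
    rewrite -[X in _ - X](GW ad); apply: le_trans (GL _ _ Wr P5) _.
    apply: le_trans (_ : L * (C2 * mu k ^+ p.+1) <= _); first by rewrite ler_pM2l.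
    rewrite mulrA; apply: le_trans (Hm1 _ muk km1) _.
    by apply: le_trans elS; rewrite -mulrA ler_pM2l.
  by rewrite (skip P2).
have [K KK0 goodK] := sub K0.
have good k : norm2 (w (K + k).+1 - ws) < rho.
  elim: k => [|k IH]; first by rewrite addn0.
  by rewrite addnS; case: (step (K + k)%N) => //; rewrite (leq_trans KK0) // leq_addr.
exists C1, C2, K; split=> // k Kk.
  by have := HK0 k (leq_trans KK0 Kk); rewrite !le_min => /andP[/andP[/andP[-> _] _] _].
have := good (k - K)%N; rewrite subnKC // => gk.
by case: (step k (leq_trans KK0 Kk) gk).
Qed.

Lemma iteration_converges :
  (forall e : R, 0 < e -> exists K : nat, forall k, (K <= k)%N -> norm2 (w k - ws) < e) /\
  (exists K : nat, forall k, (K <= k)%N ->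
     norm2 (G (wbar k) - mu k *: bv) <= eps (mu k) /\ w k.+1 = wbar k) /\
  (forall j, Rconv kappa (fun k => w k j 0) (ws j 0)) /\
  (forall j l, l != 0 -> has_slope (fun t => W (t *: bv) j 0) 0 l ->
     Qconv kappa (fun k => w k j 0) (ws j 0)).
Proof.
have [C1 [C2 [K [C10 Kmub HK]]]] := eventual_bounds.
have comp j k : (K <= k)%N -> `|w k.+1 j 0 - ws j 0| <= C1 * mu k.
  move=> /HK[h _ _ _]; apply: le_trans h; apply: le_trans (coord_le_norm2 _ j).
  by rewrite !mxE.
have muK k : (K <= k)%N -> mu k.+1 <= c2 * mu k `^ kappa.
  by move=> /Kmub/muS[].
split; [|split; [|split]].
- move=> e e0; have e0' : 0 < e / (2 * C1) by rewrite divr_gt0 // mulr_gt0.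
  have [K1 HK1] := seq_cvg0_le mucv e0'.
  exists (maxn K K1).+1; case=> // k; rewrite ltnS geq_max => /andP[/HK[h _ _ _] /HK1].
  by rewrite ler_pdivlMr ?mulr_gt0 // => h1; apply: le_lt_trans h _; lra.
- by exists K.+1; case=> // k; rewrite ltnS => /HK[].
- by move=> j; apply: (R_order k1 c20 C10 mu0 mucv muK (comp j)).
- move=> j l l0 slope.
  have al : 0 < `|l| by rewrite normr_gt0.
  (* One quarter of [|l|] pays for linearising the trajectory, one for the extrapolation error; the
     lower bound [|l| / 2] remains. *)
  have al4 : 0 < `|l| / 4 by rewrite divr_gt0.
  have [r r0 Hr] := slope _ al4.
  have r20 : 0 < r / 2 by rewrite divr_gt0.
  have [m1 m10 Hm1] := monomial_small C2 k2 (mulr_gt0 al4 c10).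
  have [K1 HK1] := seq_cvg0_le mucv r20.
  have [K2 HK2] := seq_cvg0_le mucv m10.
  (* The successor is needed because [HK k] compares [w k.+2] with the barrier point of
     [mu k.+1]. *)
  pose K3 := (maxn K (maxn K1 K2)).+1.
  have KK3 k : (K3 <= k)%N -> (K <= k)%N.
    by move=> h; apply: leq_trans (ltnW h); rewrite leq_maxl.
  have ka0 : 0 < kappa by have := k1; lra.
  have al2 : 0 < `|l| / 2 by rewrite divr_gt0.
  apply: (@Q_order _ mu _ kappa _ c2 C1 (`|l| / 2) K3 ka0 (ltW c20) al2 C10 mu0 mucv) => k.
  + by move=> /KK3; exact: muK.
  + by move=> /KK3; exact: comp.
  case: k => // k; rewrite ltnS !geq_max => /andP[Kk /andP[K1k K2k]].
  have [_ _ _ P4] := HK k Kk; have muk := mu0 k; have muk1 := mu0 k.+1.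
  have := Hm1 _ muk (HK2 k K2k); have [mul _] := muS (Kmub k Kk) => small.
  have near : `|w k.+2 j 0 - W (mu k.+1 *: bv) j 0| <= `|l| / 4 * mu k.+1.
    have -> : w k.+2 j 0 - W (mu k.+1 *: bv) j 0 = (w k.+2 - W (mu k.+1 *: bv)) j 0.
      by rewrite !mxE.
    apply: le_trans (coord_le_norm2 _ _) _; apply: le_trans P4 _; apply: le_trans small _.
    by rewrite -[leLHS]mulrA (ler_pM2l al4).
  have := Hr (mu k.+1); rewrite (gtr0_norm muk1) add0r scale0r W0 => /(_ _) lin.
  have {lin} : `|W (mu k.+1 *: bv) j 0 - ws j 0 - mu k.+1 * l| <= `|l| / 4 * mu k.+1.
    by apply: lin; have := HK1 k.+1 (leqW K1k); lra.
  move: near; set A := w k.+2 j 0; set Bx := W _ j 0; set Cx := ws j 0 => near lin.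
  have E : mu k.+1 * l = (A - Cx) - (A - Bx) - (Bx - Cx - mu k.+1 * l) by ring.
  have : mu k.+1 * `|l| <= `|A - Cx| + `|A - Bx| + `|Bx - Cx - mu k.+1 * l|.
    rewrite -{1}(gtr0_norm muk1) -normrM {1}E.
    by apply: le_trans (ler_normB _ _) _; rewrite lerD2r ler_normB.
  by lra.
Qed.

End Iteration.

(** * Algebra of continuous and continuously differentiable functions *)

Section ContAt.
Context {R : realType} {N : nat}.
Implicit Types (h g : 'cV[R]_N -> R) (x : 'cV[R]_N).

Lemma cont_at_cst a x : cont_at (fun=> a) x.
Proof. by move=> e e0; exists 1 => // y _; rewrite subrr normr0. Qed.

Lemma cont_atM h g x : cont_at h x -> cont_at g x -> cont_at (fun y => h y * g y) x.
Proof.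
move=> ch cg e e0.
have B0 : 0 < `|h x| + `|g x| + 2 by rewrite ltr_wpDl // addr_ge0.
(* The bound [e' <= 1] absorbs the product of the two increments. *)
pose e' := Num.min 1 (e / (`|h x| + `|g x| + 2)).
have e'0 : 0 < e' by rewrite lt_min ltr01 divr_gt0.
have e'1 : e' <= 1 by rewrite ge_min lexx.
have e'B : e' * (`|h x| + `|g x| + 2) <= e.
  by rewrite -ler_pdivlMr // ge_min lexx orbT.
have [d1 d10 H1] := ch e' e'0; have [d2 d20 H2] := cg e' e'0.
exists (Num.min d1 d2) => [|y]; first by rewrite lt_min d10.
rewrite lt_min => /andP[/H1 hy /H2 gy].
have -> : h y * g y - h x * g x = h x * (g y - g x) + g x * (h y - h x) + (h y - h x) * (g y - g x).
  by ring.
apply: le_lt_trans (ler_normD _ _) _; rewrite normrM.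
apply: le_lt_trans (lerD (ler_normD _ _) (lexx _)) _; rewrite !normrM.
have := normr_ge0 (h x); have := normr_ge0 (g x).
have := normr_ge0 (h y - h x); have := normr_ge0 (g y - g x); nra.
Qed.

Lemma cont_atD h g x : cont_at h x -> cont_at g x -> cont_at (fun y => h y + g y) x.
Proof.
move=> ch cg e e0; have e20 : 0 < e / 2 by rewrite divr_gt0.
have [d1 d10 H1] := ch _ e20; have [d2 d20 H2] := cg _ e20.
exists (Num.min d1 d2) => [|y]; first by rewrite lt_min d10.
rewrite lt_min => /andP[/H1 hy /H2 gy]; rewrite opprD addrACA.
by apply: le_lt_trans (ler_normD _ _) _; lra.
Qed.

End ContAt.

Section C1.
Context {R : realType} {N : nat}.
Implicit Types (h g : 'cV[R]_N -> R).

(** Carrying the partial derivatives as a witness [D] lets sums and products be handled without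
    computing [pderiv]. *)
Definition C1 h := exists D : 'I_N -> 'cV[R]_N -> R, (forall x, cont_at h x) /\
  forall i x, has_slope (fun t => h (x + t *: ej i)) 0 (D i x) /\ cont_at (D i) x.

Lemma C1_C1on h : C1 h -> C1on setT h.
Proof.
move=> [D [_ H]] i x _.
have DE : pderiv h i = D i by apply/funext => y; have [/pderivP[]] := H i y.
by have [/pderivP[hx _] cD] := H i x; rewrite DE.
Qed.

Lemma Ck_C1 k h : Ck k.+1 setT h -> C1 h.
Proof.
move=> H; exists (pderiv h); split=> [x|i x]; first exact: Ck_cont H I.
have [hx cx] := Ck_C1on H i (I : setT x); split=> //; exact/pderivP.
Qed.

Lemma C1_cst a : C1 (fun=> a).
Proof.
exists (fun _ _ => 0); split=> [x|i x]; first exact: cont_at_cst.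
by split; [exact: has_slope_cst | exact: cont_at_cst].
Qed.

Lemma C1D h g : C1 h -> C1 g -> C1 (fun x => h x + g x).
Proof.
move=> [D [ch HD]] [E [cg HE]]; exists (fun i x => D i x + E i x).
split=> [x|i x]; first exact: cont_atD.
have [d1 c1] := HD i x; have [d2 c2] := HE i x.
by split; [exact: has_slopeD | exact: cont_atD].
Qed.

Lemma C1M h g : C1 h -> C1 g -> C1 (fun x => h x * g x).
Proof.
move=> [D [ch HD]] [E [cg HE]]; exists (fun i x => h x * E i x + g x * D i x).
split=> [x|i x]; first exact: cont_atM.
have [d1 c1] := HD i x; have [d2 c2] := HE i x.
split; first by have := has_slopeM d1 d2; rewrite scale0r addr0.
by apply: cont_atD; exact: cont_atM.
Qed.

Lemma C1B h g : C1 h -> C1 g -> C1 (fun x => h x - g x).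
Proof.
move=> Hh Hg; have := C1D Hh (C1M (C1_cst (-1)) Hg).
by congr C1; apply/funext => x; rewrite mulN1r.
Qed.

Lemma C1_sum (I : Type) (r : seq I) (G : I -> 'cV[R]_N -> R) :
  (forall i, C1 (G i)) -> C1 (fun x => \sum_(i <- r) G i x).
Proof.
move=> H; elim: r => [|i r IH].
  by under eq_fun do rewrite big_nil; exact: C1_cst.
by under eq_fun do rewrite big_cons; exact: C1D.
Qed.

End C1.

(** * Smoothness of the residual and its dependence on [mu] *)

Section Residual.
Context {R : realType} {n m : nat}.
Implicit Types (w : 'cV[R]_(n + m)) (f : 'cV[R]_n -> R) (c : 'I_m -> 'cV[R]_n -> R).

Lemma norm2_xpart w : norm2 (xpart w) <= norm2 w.
Proof.
apply: norm2_le_sqr (norm2_ge0 _) _; rewrite sqr_norm2 [leRHS]big_split_ord /=.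
rewrite (eq_bigr (fun i => w (lshift m i) 0 ^+ 2)) => [|i _]; last by rewrite mxE.
by rewrite lerDl sumr_ge0 // => i _; exact: sqr_ge0.
Qed.

Lemma cont_at_xpart (h : 'cV[R]_n -> R) w :
  cont_at h (xpart w) -> cont_at (fun w => h (xpart w)) w.
Proof.
move=> H e e0; have [dl dl0 Hd] := H e e0; exists dl => // y yw; apply: Hd.
have -> : xpart y - xpart w = xpart (y - w) by apply/matrixP => i j; rewrite !mxE.
exact: le_lt_trans (norm2_xpart _) yw.
Qed.

Lemma C1_xpart (h : 'cV[R]_n -> R) : C1 h -> C1 (fun w : 'cV[R]_(n + m) => h (xpart w)).
Proof.
move=> [D [ch HD]].
exists (fun i w => if fintype.split i is inl i0 then D i0 (xpart w) else 0).
split=> [w|i w]; first exact: cont_at_xpart.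
case: (split_ordP i) => i0 ->.
  have [d1 c1] := HD i0 (xpart w); split; last exact: cont_at_xpart.
  apply: has_slope_ext d1 => t; congr (h _).
  by apply/matrixP => a b; rewrite !mxE (inj_eq (@lshift_inj _ _)).
split; last exact: cont_at_cst.
apply: has_slope_ext (has_slope_cst (h (xpart w)) 0) => t; congr (h _).
by apply/matrixP => a b; rewrite !mxE eq_lrshift mulr0 addr0.
Qed.

Lemma C1_lpart k : C1 (fun w : 'cV[R]_(n + m) => lpart w k 0).
Proof.
exists (fun i _ => (ej i : 'cV[R]_(n + m)) (rshift n k) 0); split=> [w|i w].
  move=> e e0; exists e => // y yw; apply: le_lt_trans yw.
  by apply: le_trans (coord_le_norm2 (y - w) (rshift n k)); rewrite !mxE.
split; last exact: cont_at_cst.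
have := has_slopeD (has_slope_cst (lpart w k 0) 0)
  (has_slopeZ ((ej i : 'cV[R]_(n + m)) (rshift n k) 0) (has_slope_id 0)).
by rewrite add0r mulr1; apply: has_slope_ext => t; rewrite !mxE mulrC.
Qed.

(** The upper block already contains first derivatives of [f] and [c], hence two orders of
    smoothness. *)
Lemma C1_Fmu (isI : pred 'I_m) f c d mu j : (1 < d)%N -> Ck d setT f ->
  (forall i, Ck d setT (c i)) -> C1 (fun w => Fmu isI f c mu w j 0).
Proof.
case: d => [//|[//|d]] _ fC cC; have [i ->|i ->] := split_ordP j.
- have E w : Fmu isI f c mu w (lshift m i) 0 =
      pderiv f i (xpart w) - \sum_k pderiv (c k) i (xpart w) * lpart w k 0.
    rewrite /Fmu col_mxEu !mxE; congr (_ - _).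
    by apply: eq_bigr => k _; rewrite !mxE.
  under eq_fun do rewrite E; apply: C1B.
    by apply: C1_xpart; case: fC => _ /(_ i)[_]; exact: Ck_C1.
  apply: C1_sum => k; apply: C1M (C1_lpart k).
  by apply: C1_xpart; case: (cC k) => _ /(_ i)[_]; exact: Ck_C1.
- have E w : Fmu isI f c mu w (rshift n i) 0 =
      if isI i then c i (xpart w) * lpart w i 0 - mu else c i (xpart w).
    by rewrite /Fmu col_mxEd !mxE.
  under eq_fun do rewrite E.
  have ci : C1 (fun w : 'cV[R]_(n + m) => c i (xpart w)) by apply/C1_xpart/(Ck_C1 (cC i)).
  case: (isI i) => //; apply: C1B (C1_cst _); exact: C1M ci (C1_lpart i).
Qed.

Lemma murhsE (isI : pred 'I_m) (mu : R) : @murhs R n m isI mu = mu *: murhs isI 1.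
Proof.
rewrite /murhs scale_col_mx scaler0; congr col_mx; apply/matrixP => i j.
by rewrite !mxE; case: ifP; rewrite ?mulr1 ?mulr0.
Qed.

(** The parameter only translates the residual, so one local inverse [W] serves every [mu]. *)
Lemma FmuE (isI : pred 'I_m) f c (mu : R) w :
  Fmu isI f c mu w = Fmu isI f c 0 w - mu *: murhs isI 1.
Proof.
rewrite -murhsE /Fmu /murhs opp_col_mx add_col_mx oppr0 addr0; congr col_mx.
by apply/matrixP => i j; rewrite !mxE; case: ifP; rewrite subr0.
Qed.

End Residual.

(** The default [nml 0 = 0] makes a vanishing residual an ordinary case, with [s = 0] and
    [b = 0]. *)
Lemma norm2_scale_nml {R : realType} {N : nat} (r : 'cV[R]_N) : norm2 r *: nml r = r.
Proof.
rewrite /nml; case: eqP => [->|r0]; first by rewrite scaler0.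
by rewrite scalerA divff ?scale1r //; apply/eqP => /norm2_eq0.
Qed.

Lemma norm2_nml_le1 {R : realType} {N : nat} (r : 'cV[R]_N) : norm2 (nml r) <= 1.
Proof.
rewrite /nml; case: eqP => [_|r0]; first by rewrite norm2_0.
have rn : norm2 r != 0 by apply/eqP => /norm2_eq0.
by rewrite norm2Z ger0_norm ?invr_ge0 ?norm2_ge0 // mulVf.
Qed.

Unset Implicit Arguments.

Theorem theorem1
  (R : realType) (n m : nat) (isI : pred 'I_m)
  (f : 'cV[R]_n -> R) (c : 'I_m -> 'cV[R]_n -> R) (d : nat)
  (hd : (3 <= d)%N)
  (hfC : Ck d setT f) (hcC : forall i, Ck d setT (c i))
  (xstar : 'cV[R]_n) (lstar : 'cV[R]_m)
  (hKKT : KKT isI f c xstar lstar)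
  (hLICQ : LICQ isI c xstar)
  (hSC : strict_compl isI c xstar lstar)
  (hSOSC : strong_SOSC isI f c xstar lstar)
  (huniq : forall lam, KKT isI f c xstar lam -> lam = lstar)
  (W : 'cV[R]_(n + m) -> 'cV[R]_(n + m))
  (hW : is_local_inverse isI f c d (col_mx xstar lstar) W)
  (p : nat) (hp1 : (1 <= p)%N) (hp2 : (p <= d - 2)%N)
  (kappa : R) (hk1 : 1 < kappa) (hk2 : kappa < p.+1%:R)
  (eps phi : R -> R)
  (heps_pos : forall mu, 0 < mu -> 0 < eps mu)
  (hphi_pos : forall mu, 0 < mu -> 0 < phi mu)
  (heps : bigTheta0 eps 1) (hphi : bigTheta0 phi kappa)
  (w wbar : nat -> 'cV[R]_(n + m)) (mu : nat -> R)
  (hmu0 : 0 < mu 0%N)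
  (hmuS : forall k, mu k.+1 = phi (mu k))
  (hextr : forall k, JF isI f c (mu k) (w k) \in unitmx ->
                     is_extrapolation isI f c p (mu k) (w k) (wbar k))
  (hnoextr : forall k, JF isI f c (mu k) (w k) \notin unitmx -> wbar k = w k)
  (hinner : forall k, norm2 (Fmu isI f c (mu k) (w k.+1)) <= eps (mu k))
  (hskip : forall k, norm2 (Fmu isI f c (mu k) (wbar k)) <= eps (mu k) ->
                     w k.+1 = wbar k)
  (hmu_to0 : seq_cvg mu 0)
  (sigma : nat -> nat) (hsigma : forall i, (sigma i < sigma i.+1)%N)
  (hsub : forall e : R, 0 < e -> exists N : nat, forall i, (N <= i)%N ->
            norm2 (w (sigma i).+1 - col_mx xstar lstar) < e) :
  (forall e : R, 0 < e -> exists N : nat, forall k, (N <= k)%N ->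
     norm2 (w k - col_mx xstar lstar) < e) /\
  (exists K : nat, forall k, (K <= k)%N ->
     norm2 (Fmu isI f c (mu k) (wbar k)) <= eps (mu k) /\ w k.+1 = wbar k) /\
  (forall j : 'I_(n + m),
     Rconv kappa (fun k => w k j 0) (col_mx xstar lstar j 0)) /\
  (forall j : 'I_(n + m), btraj_dot0 isI W j 0 != 0 ->
     Qconv kappa (fun k => w k j 0) (col_mx xstar lstar j 0)).
Proof.
case: hW => delta delta0 [WC W0 GW [eta eta0 uniq]].
have pd : (p < d.-1)%N by lia.
set G := Fmu isI f c 0; pose bv : 'cV[R]_(n + m) := murhs isI 1.
set ws := col_mx xstar lstar.
have FC mu' j : C1on setT (fun w => Fmu isI f c mu' w j 0).
  by apply: C1_C1on; apply: C1_Fmu hfC hcC; exact: leq_trans hd.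
have [rho [dlt [L [bounds dd]]]] :=
  local_bounds_exist (FC 0) delta0 eta0 pd WC W0 GW uniq.
have [[rho0 dlt0 L0] _ _ _ _] := bounds.
have [c1 [c2 [mb1 [c10 c20 mb10 Hphi]]]] := hphi.
have [e1 [e2 [mb2 [e10 e20 mb20 Heps]]]] := heps.
have mu0 k : 0 < mu k by elim: k => // k IH; rewrite hmuS hphi_pos.
pose mub := Num.min mb1 mb2.
have mub0 : 0 < mub by rewrite lt_min mb10.
have M0 : 0 <= (n + m)%:R * L by rewrite mulr_ge0 // ltW.
(* The subsequence therefore reaches beyond any given index. *)
have sig i : (i <= sigma i)%N.
  by elim: i => // i IH; exact: leq_ltn_trans IH (hsigma i).
have GWd r : norm2 r < dlt -> G (W r) = r by move=> rd; apply/GW/(lt_le_trans rd dd).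
have muS k : mu k <= mub ->
    c1 * mu k `^ kappa <= mu k.+1 /\ mu k.+1 <= c2 * mu k `^ kappa.
  by rewrite le_min hmuS => /andP[mk _]; apply: Hphi.
have epsE k : mu k <= mub -> e1 * mu k <= eps (mu k) /\ eps (mu k) <= e2 * mu k.
  by rewrite le_min => /andP[_ mk]; have := Heps _ (mu0 k) mk; rewrite powRr1 // ltW.
have inner k : norm2 (G (w k.+1) - mu k *: bv) <= eps (mu k).
  by rewrite -FmuE.
have skip k : norm2 (G (wbar k) - mu k *: bv) <= eps (mu k) -> w k.+1 = wbar k.
  by rewrite -FmuE; exact: hskip.
have extr k : norm2 (w k - ws) < rho ->
    norm2 (mu k *: bv) + 2 * norm2 (G (w k) - mu k *: bv) < dlt ->
    norm2 (wbar k - W (mu k *: bv)) <=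
      (n + m)%:R * L * norm2 (G (w k) - mu k *: bv) ^+ p.+1.
  move=> wr; rewrite -FmuE => small.
  (* Near [ws] the Jacobian is invertible, so the extrapolation branch of the algorithm is the one
     taken. *)
  have /hextr[v [[C [dl dl0 HC]] ->]] : JF isI f c (mu k) (w k) \in unitmx.
    exact: (jacobian_unit bounds (FC (mu k)) (FmuE isI f c (mu k)) wr).
  have Gw : G (w k) = mu k *: bv + norm2 (Fmu isI f c (mu k) (w k)) *: nml (Fmu isI f c (mu k) (w k)).
    by rewrite norm2_scale_nml FmuE addrC subrK.
  rewrite -mulrA; apply: (extrapolation_error bounds dd pd WC wr (norm2_nml_le1 _)
    (norm2_ge0 _) Gw small dl0 (v := v) (C := C)) => x xs.
  by rewrite -FmuE; exact: HC.
have sub K : exists2 k, (K <= k)%N & norm2 (w k.+1 - ws) < rho.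
  have [N0 HN0] := hsub rho rho0; exists (sigma (maxn K N0)).
    exact: leq_trans (leq_maxl _ _) (sig _).
  exact/HN0/leq_maxr.
have [cvg [fast [Rc Qc]]] := iteration_converges bounds W0 GWd hk1 hk2 M0 c10 c20 e10 e20
  mub0 mu0 hmu_to0 muS epsE inner skip extr sub.
split=> //; split.
  by have [K HK] := fast; exists K => k /HK[acc ->]; split=> //; rewrite FmuE; exact: acc.
split=> // j dj; apply: (Qc j _ dj).
have U0 : [set r : 'cV[R]_(n + m) | norm2 r < delta]%classic 0 by rewrite /= norm2_0.
have WC1 : C1on [set r : 'cV[R]_(n + m) | norm2 r < delta]%classic (fun r => W r j 0).
  by move: (WC j); rewrite -(ltn_predK pd); exact: Ck_C1on.
have := C1on_slope bv (@norm2_open_ball0 _ _ delta) WC1 U0.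
set l := \sum_i _ => slope.
(* [derive1] is total; its value is known to be [l] only because [W] is shown to have that slope
   along [bv]. *)
suff -> : btraj_dot0 isI W j 0 = l by apply: has_slope_ext slope => t; rewrite add0r.
rewrite mxE derive1E /btraj.
under eq_fun do rewrite murhsE -/bv -[_ *: bv]add0r.
by have /is_derive_slope[_ ->] := slope.
Qed.
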